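(* Let $G=[g_1,g_2,\ldots]$ be a transcendental semigroup. Then any constant limit function of $G$ on an invariant component of $F(G)$ lies in $\mathcal{P}(G)\cup\{\infty\}$.
   Context: A transcendental semigroup $G=[g_1,g_2,\ldots]$ is the semigroup generated under composition by a family $\{g_1,g_2,\ldots\}$ of transcendental entire functions. The Fatou set $F(G)$ is the largest open subset of $\mathbb{C}$ on which the family $G$ is normal (every sequence in $G$ has a subsequence converging locally uniformly to a holomorphic function or to $\infty$). A connected component $U$ of $F(G)$ is invariant if $g(U)\subset U$ for all $g\in G$. A function $\psi$ (possibly the constant $\infty$) is a limit function of $G$ on $U$ if every sequence in $G$ has some subsequence which converges locally uniformly on $U$ to $\psi$; a constant limit function is identified with its value in $\mathbb{C}\cup\{\infty\}$. For a transcendental entire function $f$, $\mathrm{Sing}(f^{-1})$ is the set of critical values and asymptotic values of $f$ and their finite limit points, where $\zeta\in\mathbb{C}$ is an asymptotic value of $f$ if there is a curve $\Gamma$ tending to infinity with $f(z)\to\zeta$ as $z\to\infty$ along $\Gamma$. Finally $\mathcal{P}(G)=\overline{\bigcup_{f\in G}\mathrm{Sing}(f^{-1})}$. *)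

(* Defs.v *)
From HB Require Import structures.
From mathcomp Require Import all_boot all_order all_algebra.
From mathcomp Require Import complex.
From mathcomp Require Import boolp classical_sets functions reals.
From mathcomp Require Import topology normedtype derive.

Set Implicit Arguments.
Unset Strict Implicit.
Unset Printing Implicit Defensive.

Import Order.TTheory GRing.Theory Num.Theory numFieldNormedType.Exports.

Local Open Scope classical_set_scope.
Local Open Scope complex_scope.
Local Open Scope ring_scope.

(* R[i] bundled as a numClosedFieldType: the topology and the norm that
   MathComp-Analysis attaches to number fields are inferred for the carrier of
   a bundled field, not for the bare type R[i]. *)
Definition cplx (R : realType) : numClosedFieldType := R[i].

Section TranscendentalSemigroups.
Variable R : realType.
Local Notation C := (cplx R).
Implicit Types (f h : C -> C) (s : nat -> C -> C) (G : set (C -> C))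
  (U V : set C) (psi : option (C -> C)).

(* The scalar field of C as a normed space is C itself, so that this is
   complex differentiability. *)
Definition holomorphic_on V f := forall z, V z -> derivable f z 1.

Definition entire f := holomorphic_on setT f.

Definition transcendental_entire f :=
  entire f /\ ~ exists p : {poly C}, forall z, f z = p.[z].

(* A family g_1, g_2, ... is indexed by nat; since repetitions are allowed,
   this covers finite nonempty families as well. *)
Inductive semigroup (g : nat -> C -> C) : set (C -> C) :=
| semigroup_gen n : semigroup g (g n)
| semigroup_comp f h : semigroup g f -> semigroup g h -> semigroup g (f \o h).

(* [None] stands for the constant infinity. *)
Definition cvg_locally_uniformly U s psi :=
  forall z, U z -> exists2 N, nbhs z N &
    match psi with
    | Some h => {uniform N `&` U, s @ \oo --> h}
    | None => forall M : R, \forall n \near \oo,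
                forall w, N w -> U w -> (M%:C : C) < `|s n w|
    end.

Definition subsequence s (t : nat -> C -> C) :=
  exists2 k : nat -> nat, {homo k : m n / (m < n)%N} & t = s \o k.

Definition normal_on G V := forall s, (forall n, G (s n)) ->
  exists t psi, [/\ subsequence s t, cvg_locally_uniformly V t psi &
    if psi is Some h then holomorphic_on V h else True].

(* Normality is local, and the largest open set on which G is normal is
   rendered as the union of all open sets on which it is.  In this way it does
   not matter that, for a disconnected V, [normal_on] does not allow the limit
   to be infinite on some components and finite on others. *)
Definition Fatou G : set C :=
  \bigcup_(V in [set V | open V /\ normal_on G V]) V.

Definition Fatou_component G U :=
  exists2 z, Fatou G z & U = connected_component (Fatou G) z.

Definition invariant_under G U := forall g, G g -> g @` U `<=` U.

(* The sequences are sequences of pairwise distinct elements of G: along a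
   constant sequence g, g, ... the only possible limit is the nonconstant g,
   so that without this proviso there is never a constant limit function. *)
Definition limit_function G U psi :=
  forall s, (forall n, G (s n)) -> injective s ->
  exists2 t, subsequence s t & cvg_locally_uniformly U t psi.

(* The extended plane is [option C], with [None] for infinity. *)
Definition constant_value U psi (v : option C) :=
  match psi with
  | Some h => exists2 c, v = Some c & forall z, U z -> h z = c
  | None => v = None
  end.

Definition critical_values f : set C := [set f z | z in [set z | derive1 f z = 0]].

Definition asymptotic_values f : set C := [set zeta |
  exists gamma : R -> C,
  [/\ {within [set t | 0 <= t], continuous gamma},
      forall M : R, \forall t \near +oo, (M%:C : C) < `|gamma t| &
      f (gamma t) @[t --> +oo] --> zeta]].

Definition Sing f : set C :=
  let A := critical_values f `|` asymptotic_values f in A `|` limit_point A.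

Definition postsingular_set G : set C := closure (\bigcup_(f in G) Sing f).

End TranscendentalSemigroups.

(* Main.v *)
(* Every injective sequence of iterates of f = g_0 has a subsequence that tends
   to c on U.  Hence f^n -> c on U and f c = c.  Suppose that c is not in the
   postsingular set.  On a fixed disk D about c every f^n then has an inverse
   branch phi_n that fixes c: a lift along a radius that cannot be continued
   would produce an asymptotic value in D.  Let l be the multiplier of c; it is
   nonzero.  If |l| < 1, the derivatives l^-n of the phi_n at c tend to infinity,
   so by the Koebe theorem f is univalent on arbitrarily large disks, hence
   affine.  If |l| > 1, or if |l| = 1 (where the Koebe theorem makes the phi_n
   equicontinuous at c), an orbit can tend to c only by hitting it; then c is in
   U, and locally uniform convergence at c forces l^n -> 0 along a subsequence.

   Function theory rests on a maximum principle with a finite exceptional set,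
   obtained from Goursat's bisection argument applied to trapezoidal sums instead
   of integrals.  Applied to difference quotients, it yields Lipschitz and second
   order estimates, local inverses, the identity theorem and a Liouville theorem. *)

(* A single generator is enough: a constant limit function constrains every injective sequence in
   the semigroup, in particular the iterates of [g 0], which are distinct because [g 0] is not
   affine. The postsingular set is closed and collects the singular values of all iterates, so one
   disk about c serves every n; the Koebe theorem needs this common radius. At first c is known only
   as a limit of orbits and may lie on the boundary of U; this is why an orbit must be made to hit c
   before invariance puts c into U. No integral is ever formed. Trapezoidal sums keep what Goursat's
   argument uses, namely linearity, exactness on affine functions and cancellation along inner
   edges, and the value 2 pi i of the Cauchy kernel is replaced by a lower bound for an imaginary
   part. The resulting estimate has a constant that is not sharp, and passing to powers removes it.
   In the same spirit the Koebe constant 1/4 is replaced by 1/320, which comes from a square root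
   and a derivative bound; only its independence of the function matters. *)
Require Import Defs.
From mathcomp Require Import all_boot all_order all_algebra.
From mathcomp Require Import complex.
From mathcomp Require Import boolp classical_sets functions reals.
From mathcomp Require Import topology normedtype derive.
From mathcomp Require Import zify ring lra.

Set Implicit Arguments.
Unset Strict Implicit.
Unset Printing Implicit Defensive.

Import Order.TTheory GRing.Theory Num.Theory numFieldNormedType.Exports.

Local Open Scope classical_set_scope.
Local Open Scope ring_scope.

(** * Complex modulus and complex derivative *)

(* The norm of [cplx R] takes its values in [cplx R] itself; [cabs] is the same
   number in the totally ordered field [R]. *)
Definition cabs (R : realType) (z : cplx R) : R := Normc.normc z.
Definition rc (R : realType) (t : R) : cplx R := real_complex R t.

Section Modulus.
Variable R : realType.
Local Notation C := (cplx R).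
Local Notation N := (@cabs R).
Implicit Types (x y z w : C) (f h : C -> C).

Lemma normC_cabs z : `|z| = rc (N z).
Proof. by []. Qed.

Lemma cabs0 : N 0 = 0. Proof. exact: Normc.normc0. Qed.
Lemma cabs1 : N 1 = 1. Proof. exact: Normc.normc1. Qed.
Lemma cabsM z w : N (z * w) = N z * N w. Proof. exact: Normc.normcM. Qed.
Lemma cabsN z : N (- z) = N z. Proof. exact: normcN. Qed.
Lemma cabsV z : N z^-1 = (N z)^-1. Proof. exact: Normc.normcV. Qed.
Lemma cabsD z w : N (z + w) <= N z + N w. Proof. exact: le_normcD. Qed.

Lemma cabs_ge0 z : 0 <= N z.
Proof. by rewrite /cabs; case: (z) => a b; rewrite sqrtr_ge0. Qed.

Lemma cabs_eq0 z : (N z == 0) = (z == 0).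
Proof.
apply/eqP/eqP => [|->]; last exact: cabs0.
exact: Normc.eq0_normc.
Qed.

Lemma cabs_gt0 z : (0 < N z) = (z != 0).
Proof. by rewrite lt_neqAle cabs_ge0 andbT eq_sym cabs_eq0. Qed.

Lemma cabsf z w : N (z / w) = N z / N w. Proof. by rewrite cabsM cabsV. Qed.

Lemma cabsX z n : N (z ^+ n) = N z ^+ n.
Proof. by elim: n => [|n IH]; rewrite ?expr0 ?cabs1 // !exprS cabsM IH. Qed.

Lemma cabsC z w : N (z - w) = N (w - z).
Proof. by rewrite -cabsN opprB. Qed.

Lemma cabsB z w : N (z - w) <= N z + N w.
Proof. by rewrite -(cabsN w) cabsD. Qed.

Lemma cabs_tri z w x : N (z - x) <= N (z - w) + N (w - x).
Proof. by rewrite -[z - x](subrKA w) cabsD. Qed.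

Lemma cabs_rev z w : N z - N w <= N (z - w).
Proof. by have := cabsD (z - w) w; rewrite subrK; lra. Qed.

Lemma rcB (s t : R) : rc (s - t) = rc s - rc t. Proof. exact: rmorphB. Qed.
Lemma rcV (s : R) : rc s^-1 = (rc s)^-1. Proof. exact: fmorphV. Qed.
Lemma rc0 : rc (0 : R) = 0. Proof. by []. Qed.
Lemma rc1 : rc (1 : R) = 1. Proof. by []. Qed.
Lemma rc_nat n : rc (n%:R : R) = n%:R. Proof. exact: rmorph_nat. Qed.

Lemma ltr_rc (s t : R) : (rc s < rc t) = (s < t). Proof. exact: ltcR. Qed.

Lemma cabs_rc (t : R) : N (rc t) = `|t|.
Proof. by rewrite /cabs /rc /= expr0n /= addr0 sqrtr_sqr. Qed.

Lemma cabs_nat n : N n%:R = n%:R.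
Proof. by rewrite -rc_nat cabs_rc ger0_norm. Qed.

Lemma gt0_rcE (e : C) : 0 < e -> exists2 d : R, 0 < d & e = rc d.
Proof.
case: e => a b; rewrite ltcE /= => /andP[/eqP b0 a0].
by exists a => //; rewrite /rc /= b0.
Qed.

Lemma nbhsP z (P : set C) :
  nbhs z P <-> exists2 d : R, 0 < d & forall y, N (y - z) < d -> P y.
Proof.
split=> [/nbhs_ballP[e /= /gt0_rcE[d d0 ->] H]|[d d0 H]].
  exists d => // y yz; apply: H; rewrite /ball /= normC_cabs ltr_rc.
  by rewrite cabsC.
apply/nbhs_ballP; exists (rc d) => /=; first by rewrite -rc0 ltr_rc.
by move=> y; rewrite /ball /= normC_cabs ltr_rc cabsC => /H.
Qed.

Lemma cvg_cabsP (T : Type) (F : set_system T) (FF : Filter F) (u : T -> C) l :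
  u @ F --> l <-> forall e : R, 0 < e -> \forall t \near F, N (u t - l) < e.
Proof.
split=> [H e e0|H].
  by apply: (H [set x | N (x - l) < e]); apply/nbhsP; exists e.
by move=> P /nbhsP[d d0 HP]; apply: filterS (H _ d0) => t /HP.
Qed.

Definition ctsat f z := forall e : R, 0 < e -> exists2 d : R, 0 < d &
  forall x, N (x - z) < d -> N (f x - f z) < e.

Definition seqlim (u : nat -> C) l :=
  forall e : R, 0 < e -> exists n0, forall n, (n0 <= n)%N -> N (u n - l) < e.

Lemma seqlim_cts f z (u : nat -> C) : ctsat f z ->
  seqlim u z -> seqlim (f \o u) (f z).
Proof.
move=> fz uz e /fz[d /uz[n0 H] Hd].
by exists n0 => n /H /Hd.
Qed.

Lemma seqlim_unique (u : nat -> C) a b : seqlim u a -> seqlim u b -> a = b.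
Proof.
move=> ua ub; apply/eqP; rewrite -subr_eq0 -cabs_eq0; apply: contraT => ab.
have d0 : 0 < N (a - b) / 2 by rewrite divr_gt0 // lt_neqAle eq_sym ab cabs_ge0.
have [n Hn] := ua _ d0; have [m Hm] := ub _ d0.
have := Hn _ (leq_maxl n m); have := Hm _ (leq_maxr n m).
have := cabs_tri a (u (maxn n m)) b; rewrite (cabsC a (u _)); lra.
Qed.

Lemma rc_continuous : continuous (@rc R : R -> C).
Proof.
move=> t; apply/cvg_cabsP => e e0.
by near=> s; rewrite -rcB cabs_rc distrC; near: s; exact: cvgr_dist_lt.
Unshelve. all: by end_near. Qed.

(** The compact set is the square of half side [M], carried over from [R * R] by [J]. Stating that
    [w] is a cluster point spares the extraction of subsequences later on. *)
Lemma bolzano_weierstrass (u : nat -> C) (M : R) : (forall n, N (u n) <= M) ->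
  exists w, forall e : R, 0 < e -> forall n,
    exists2 m, (n <= m)%N & N (u m - w) < e.
Proof.
move=> uM.
pose J (p : R * R) : C := rc p.1 + 'i * rc p.2.
pose K := [set p : R * R | `[-M, M]%classic p.1 /\ `[-M, M]%classic p.2].
have cJ : continuous J.
  move=> p; apply: cvgD; last apply: cvgM; first last.
  - by apply: continuous_comp; [exact: cvg_snd | exact: rc_continuous].
  - exact: cvg_cst.
  - by apply: continuous_comp; [exact: cvg_fst | exact: rc_continuous].
have cK : compact K.
  exact: (@compact_setX _ _ `[-M, M]%classic `[-M, M]%classic
    (@segment_compact _ _ _) (@segment_compact _ _ _)).
have cJK : compact (J @` K).
  by apply: continuous_compact => //; apply: continuous_subspaceT.
have uK : forall n, (J @` K) (u n).
  move=> n; have := uM n.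
  case: (u n) => a b; rewrite /cabs /= => h.
  have M0 : 0 <= M by apply: le_trans h; rewrite sqrtr_ge0.
  have hM : a ^+ 2 + b ^+ 2 <= M ^+ 2.
    by rewrite -(ler_sqrt _ (sqr_ge0 M)) sqrtr_sqr ger0_norm.
  exists (a, b); last first.
    by rewrite /J /= [RHS]complexE /=; congr (_ + _ * _).
  by split; rewrite /= in_itv /=; apply/andP; split;
    have := sqr_ge0 a; have := sqr_ge0 b; nra.
have uF : (u @ \oo) (J @` K) by exists 0%N => // n _; exact: uK.
have [w [_ Hw]] := cJK (u @ \oo) _ uF.
exists w => e e0 n.
have [] := Hw [set x | exists2 m, (n <= m)%N & x = u m]
  [set x | N (x - w) < e] _ _.
- by exists n => // m /= nm; exists m.
- by apply/nbhsP; exists e.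
- by move=> x [[m nm ->] ?]; exists m.
Qed.

End Modulus.

Section ComplexDerivative.
Variable R : realType.
Local Notation C := (cplx R).
Local Notation N := (@cabs R).
Implicit Types (x y z w : C) (f h : C -> C).

Lemma cts_cst (a : C) z : ctsat (fun=> a) z.
Proof. by move=> e e0; exists 1 => // x _; rewrite subrr cabs0. Qed.

Lemma cts_id z : ctsat (fun x : C => x) z.
Proof. by move=> e e0; exists e. Qed.

Lemma ctsD f h z : ctsat f z -> ctsat h z -> ctsat (fun x => f x + h x) z.
Proof.
move=> fz hz e e0; have e20 : 0 < e / 2 by rewrite divr_gt0.
have [d d0 Hd] := fz _ e20; have [d' d'0 Hd'] := hz _ e20.
exists (Num.min d d') => [|x]; rewrite lt_min ?d0 // => /andP[/Hd h1 /Hd' h2].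
have -> : f x + h x - (f z + h z) = (f x - f z) + (h x - h z) by ring.
by apply: le_lt_trans (cabsD _ _) _; lra.
Qed.

Lemma ctsM f h z : ctsat f z -> ctsat h z -> ctsat (fun x => f x * h x) z.
Proof.
move=> fz hz e e0; have F0 := cabs_ge0 (f z); have H0 := cabs_ge0 (h z).
have e1 : 0 < e / 2 / (N (h z) + 1) by rewrite !divr_gt0 //; lra.
have e2 : 0 < e / 2 / (N (f z) + 1) by rewrite !divr_gt0 //; lra.
have [d d0 Hd] := fz _ e1; have [d' d'0 Hd'] := hz _ e2.
have [d2 d20 Hd2] := hz 1 ltr01.
exists (Num.min d (Num.min d' d2)) => [|x]; rewrite !lt_min ?d0 ?d'0 //.
move=> /and3P[/Hd h1 /Hd' h2 /Hd2 h3].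
have -> : f x * h x - f z * h z = (f x - f z) * h x + f z * (h x - h z) by ring.
apply: le_lt_trans (cabsD _ _) _; rewrite !cabsM.
have h4 : N (h x) <= N (h z) + 1 by have := cabs_rev (h x) (h z); lra.
have H1 : 0 < N (h z) + 1 by lra.
have F1 : 0 < N (f z) + 1 by lra.
move: h1 h2; rewrite (ltr_pdivlMr _ _ H1) (ltr_pdivlMr _ _ F1) => h1 h2.
have := cabs_ge0 (f x - f z); have := cabs_ge0 (h x - h z); nra.
Qed.

Lemma ctsB f h z : ctsat f z -> ctsat h z -> ctsat (fun x => f x - h x) z.
Proof.
move=> fz hz; have -> : (fun x => f x - h x) = fun x => f x + (-1) * h x.
  by apply/funext => x; ring.
by apply: ctsD => //; apply: ctsM => //; exact: cts_cst.
Qed.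

Lemma ctsV f z : f z != 0 -> ctsat f z -> ctsat (fun x => (f x)^-1) z.
Proof.
move=> f0 fz e e0; set A := N (f z); have A0 : 0 < A by rewrite cabs_gt0.
have e1 : 0 < Num.min (A / 2) (e * A ^+ 2 / 2).
  by rewrite lt_min !divr_gt0 // mulr_gt0 // exprn_gt0.
have [d d0 Hd] := fz _ e1; exists d => // x /Hd; rewrite lt_min => /andP[h1 h2].
have h3 : A / 2 <= N (f x) by have := cabs_rev (f z) (f x); rewrite cabsC -/A; lra.
have fx0 : f x != 0 by rewrite -cabs_gt0; lra.
have -> : (f x)^-1 - (f z)^-1 = - (f x - f z) / (f x * f z) by field; apply/andP.
rewrite cabsf cabsN cabsM -/A ltr_pdivrMr; last by rewrite mulr_gt0 // cabs_gt0.
have h4 : 0 <= e * A * (N (f x) - A / 2) by rewrite !mulr_ge0 //; lra.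
by apply: lt_le_trans h2 _; lra.
Qed.

Lemma cts_comp f h z : ctsat f z -> ctsat h (f z) ->
  ctsat (fun x => h (f x)) z.
Proof.
move=> fz hz; move=> e /hz[d /fz[d' d'0 Hf] Hh].
by exists d' => // x /Hf /Hh.
Qed.

Lemma cts_near f h z (d : R) : 0 < d -> (forall x, N (x - z) < d -> f x = h x) ->
  ctsat f z -> ctsat h z.
Proof.
move=> d0 fh fz; move=> e /fz[d' d'0 Hf].
exists (Num.min d d'); first by rewrite lt_min d0.
move=> x; rewrite lt_min => /andP[xd xd'].
by rewrite -!fh ?subrr ?cabs0 //; exact: Hf.
Qed.

(* Caratheodory's form of differentiability. *)
Definition isD f z l := exists q : C -> C,
  [/\ ctsat q z, q z = l & forall x, f x - f z = q x * (x - z)].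

(** If [l] is the derivative, the value filled in at [z] makes the quotient continuous there, but
    gives no derivative at [z]. Such points become the exceptional points of the maximum
    principle. *)
Definition dslope f z l x := if x == z then l else (f x - f z) / (x - z).

Lemma dslopeK f z l x : f x - f z = dslope f z l x * (x - z).
Proof.
rewrite /dslope; case: eqVneq => [->|xz]; first by rewrite !subrr mulr0.
by rewrite divfK // subr_eq0.
Qed.

Lemma dslopexx f z l : dslope f z l z = l.
Proof. by rewrite /dslope eqxx. Qed.

Lemma isD_dslope f z l : isD f z l -> ctsat (dslope f z l) z.
Proof.
move=> [q [cq qz Hq]]; suff -> : dslope f z l = q by [].
apply/funext => x; rewrite /dslope; case: eqVneq => [->//|xz].
by rewrite Hq mulfK // subr_eq0.
Qed.

Lemma dslope_isD f z l : ctsat (dslope f z l) z -> isD f z l.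
Proof.
move=> H; exists (dslope f z l); split => //; first exact: dslopexx.
by move=> x; exact: dslopeK.
Qed.

Lemma isDP f z l : isD f z l <-> forall e : R, 0 < e -> exists2 d : R, 0 < d &
  forall x, N (x - z) < d -> N (f x - f z - l * (x - z)) <= e * N (x - z).
Proof.
split=> [[q [cq qz Hq]] e e0|H].
  have [d d0 Hd] := cq _ e0; exists d => // x /Hd; rewrite qz => /ltW ?.
  by rewrite Hq -mulrBl cabsM ler_wpM2r // cabs_ge0.
apply: dslope_isD; move=> e e0.
have e20 : 0 < e / 2 by rewrite divr_gt0.
have [d d0 Hd] := H _ e20.
exists d => // x /Hd; rewrite dslopexx; case: (eqVneq x z) => [-> _|xz].
  by rewrite dslopexx subrr cabs0.
rewrite (dslopeK f z l) -mulrBl cabsM ler_pM2r ?cabs_gt0 ?subr_eq0 //.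
by move=> h; apply: le_lt_trans h _; lra.
Qed.

Lemma isD_cts f z l : isD f z l -> ctsat f z.
Proof.
move=> [q [cq _ Hq]].
have -> : f = fun x => f z + q x * (x - z) by apply/funext => x; rewrite -Hq; ring.
apply: ctsD; first exact: cts_cst.
by apply: ctsM => //; apply: ctsB; [exact: cts_id | exact: cts_cst].
Qed.

Lemma isD_unique f z l m : isD f z l -> isD f z m -> l = m.
Proof.
move=> /isDP Hl /isDP Hm; apply/eqP; rewrite -subr_eq0 -cabs_eq0.
apply: contraT => lm.
have e0 : 0 < N (l - m) / 3 by rewrite divr_gt0 // lt_neqAle eq_sym lm cabs_ge0.
have [d d0 Hd] := Hl _ e0; have [d' d'0 Hd'] := Hm _ e0.
pose t := Num.min d d' / 2; have t0 : 0 < t by rewrite divr_gt0 // lt_min d0.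
have td : t < d.
  by rewrite /t ltr_pdivrMr // gt_min; apply/orP; left; lra.
have td' : t < d'.
  by rewrite /t ltr_pdivrMr // gt_min; apply/orP; right; lra.
have xz : N (z + rc t - z) = t by rewrite addrC addKr cabs_rc ger0_norm // ltW.
have := Hd (z + rc t); have := Hd' (z + rc t); rewrite !xz => /(_ td') h1 /(_ td) h2.
have := cabsB (f (z + rc t) - f z - m * (z + rc t - z))
  (f (z + rc t) - f z - l * (z + rc t - z)).
have -> : f (z + rc t) - f z - m * (z + rc t - z) -
  (f (z + rc t) - f z - l * (z + rc t - z)) = (l - m) * (z + rc t - z) by ring.
rewrite cabsM xz; nra.
Qed.

Lemma isD_near f h z l (d : R) : 0 < d ->
  (forall x, N (x - z) < d -> f x = h x) -> isD f z l -> isD h z l.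
Proof.
move=> d0 fh /isDP H; apply/isDP => e /H[d' d'0 Hd'].
exists (Num.min d d'); first by rewrite lt_min d0.
move=> x; rewrite lt_min => /andP[xd xd'].
by rewrite -!fh // ?subrr ?cabs0 //; exact: Hd'.
Qed.

Lemma isD_cst (a : C) z : isD (fun=> a) z 0.
Proof. by exists (fun=> 0); split=> // [|x]; [exact: cts_cst|rewrite subrr mul0r]. Qed.

Lemma isD_id z : isD (fun x => x) z 1.
Proof. by exists (fun=> 1); split=> // [|x]; [exact: cts_cst|rewrite mul1r]. Qed.

Lemma isDD f h z l m : isD f z l -> isD h z m -> isD (fun x => f x + h x) z (l + m).
Proof.
move=> [q [cq <- Hq]] [p [cp <- Hp]]; exists (fun x => q x + p x); split => //.
  exact: ctsD.
by move=> x; rewrite mulrDl -Hq -Hp; ring.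
Qed.

Lemma isDB f h z l m : isD f z l -> isD h z m -> isD (fun x => f x - h x) z (l - m).
Proof.
move=> [q [cq <- Hq]] [p [cp <- Hp]]; exists (fun x => q x - p x); split => //.
  exact: ctsB.
by move=> x; rewrite mulrBl -Hq -Hp; ring.
Qed.

Lemma isDM f h z l m : isD f z l -> isD h z m ->
  isD (fun x => f x * h x) z (l * h z + f z * m).
Proof.
move=> fD [p [cp <- Hp]]; have cf := isD_cts fD.
have [q [cq <- Hq]] := fD.
exists (fun x => q x * h z + f x * p x); split => //.
  apply: ctsD; apply: ctsM => //; exact: cts_cst.
by move=> x; rewrite mulrDl mulrAC -Hq -mulrA -Hp; ring.
Qed.

Lemma isDV f z l : f z != 0 -> isD f z l ->
  isD (fun x => (f x)^-1) z (- l / f z ^+ 2).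
Proof.
move=> f0 fD; have /(_ (N (f z))) := isD_cts fD.
rewrite cabs_gt0 => /(_ f0)[d d0 Hd].
have fn0 x : N (x - z) < d -> f x != 0.
  by move=> /Hd; apply: contraTneq => ->; rewrite sub0r cabsN ltxx.
(* The slope must be defined for all [x], also where [f] vanishes; replacing those values by [f z]
   changes nothing near [z]. *)
pose f' x := if f x == 0 then f z else f x.
have f'0 x : f' x != 0 by rewrite /f'; case: ifP => // /negbT.
have ff' x : N (x - z) < d -> f x = f' x.
  by move=> /fn0/negbTE fx; rewrite /f' fx.
have f'D : isD f' z l by apply: isD_near fD; [exact: d0|].
have f'z : f' z = f z by rewrite /f' (negbTE f0).
suff : isD (fun x => (f' x)^-1) z (- l / f z ^+ 2).
  by apply: isD_near d0 _ => x /ff' ->.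
have cf' := isD_cts f'D; have [q [cq <- Hq]] := f'D.
exists (fun x => - q x / (f' x * f' z)); split.
- apply: ctsM; last first.
    apply: ctsV; first by rewrite mulf_neq0.
    by apply: ctsM => //; exact: cts_cst.
  have -> : (fun x => - q x) = (fun x => 0 - q x) by apply/funext => x; rewrite sub0r.
  by apply: ctsB => //; exact: cts_cst.
- by rewrite f'z expr2.
- move=> x.
  have -> : - q x / (f' x * f' z) * (x - z) = - (q x * (x - z)) / (f' x * f' z) by ring.
  by rewrite -Hq; field; rewrite !f'0.
Qed.

Lemma isD_comp f h z l m : isD f z l -> isD h (f z) m ->
  isD (fun x => h (f x)) z (m * l).
Proof.
move=> fD [p [cp <- Hp]]; have cf := isD_cts fD.
have [q [cq <- Hq]] := fD.
exists (fun x => p (f x) * q x); split => //.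
  by apply: ctsM => //; exact: cts_comp.
by move=> x; rewrite Hp Hq; ring.
Qed.

Lemma isDX f z l n : isD f z l -> exists m, isD (fun x => f x ^+ n) z m.
Proof.
move=> fD; elim: n => [|n [m IH]]; first by exists 0; exact: isD_cst.
exists (l * f z ^+ n + f z * m).
have -> : (fun x => f x ^+ n.+1) = (fun x => f x * f x ^+ n).
  by apply/funext => x; rewrite exprS.
exact: isDM.
Qed.

Lemma cvg_isD f z l :
  (fun h : C => h^-1 *: (f (h + z) - f z)) @ 0^' --> l <-> isD f z l.
Proof.
split=> [H|fD].
  apply: dslope_isD => e e0; rewrite dslopexx.
  have /cvg_cabsP/(_ _ e0)/nbhsP[d d0 Hd] := H.
  exists d => // x xd; rewrite /dslope; case: (eqVneq x z) => [_|xz].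
    by rewrite subrr cabs0.
  have := Hd (x - z); rewrite subr0 => /(_ xd).
  by rewrite subr_eq0 subrK [_ *: _]mulrC => /(_ xz).
apply/cvg_cabsP => e /(isD_dslope fD)[d d0 Hd].
apply/nbhsP; exists d => // h; rewrite subr0 => hd h0.
have := Hd (h + z); rewrite addrK => /(_ hd); rewrite dslopexx /dslope.
case: (eqVneq (h + z) z) => [/eqP|_]; last by rewrite addrK [_ *: _]mulrC.
by rewrite -subr_eq0 addrK => /eqP h00; rewrite h00 eqxx in h0.
Qed.

Lemma derivable_isD f z : derivable f z 1 -> isD f z (derive1 f z).
Proof.
move=> fD; apply/cvg_isD; rewrite derive1E; move: fD; rewrite /derivable /derive.
have -> // : (fun h : C => h^-1 *: ((f \o shift z) (h *: 1) - f z)) =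
   (fun h : C => h^-1 *: (f (h + z) - f z)).
by apply/funext => h /=; rewrite [h *: 1]mulr1.
Qed.

Lemma isD_derive1 f z l : isD f z l -> derive1 f z = l.
Proof. by move=> /cvg_isD fD; apply: cvg_lim => //; exact: norm_hausdorff. Qed.

End ComplexDerivative.

(** * The maximum principle *)

Section Goursat.
Variable R : realType.
Local Notation C := (cplx R).
Local Notation N := (@cabs R).
Implicit Types (x y z w a b c : C) (f h : C -> C) (P Q D : set C) (k : nat).

(* [chord h k a b] is the trapezoidal sum of h along the segment from a to b
   subdivided into 2 ^ k parts.  It is additive under bisection if k drops by 1,
   and exact on affine functions. *)
Fixpoint avg h k a b : C :=
  if k is k'.+1 then
    (avg h k' a ((a + b) / 2) + avg h k' ((a + b) / 2) b) / 2
  else (h a + h b) / 2.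

Definition chord h k a b := (b - a) * avg h k a b.

Definition tri h k a b c := chord h k a b + chord h k b c + chord h k c a.

(** The sums sample [h] only at dyadic points of a segment, so stability under midpoints does the
    work of convexity. *)
Definition midclosed P := forall x y, P x -> P y -> P ((x + y) / 2).

(** With a disk for [Q] this bounds moduli; with a half plane it bounds the imaginary part of the
    Cauchy kernel from below. *)
Lemma avg_midclosed h P Q k a b : midclosed P -> midclosed Q ->
  (forall x, P x -> Q (h x)) -> P a -> P b -> Q (avg h k a b).
Proof.
move=> mP mQ PQ; elim: k a b => [|k IH] a b Pa Pb /=; first by apply: mQ; exact: PQ.
by apply: mQ; apply: IH => //; exact: mP.
Qed.

Lemma half_ball w r : midclosed [set x | N (x - w) <= r].
Proof.
move=> x y /= xr yr.
have -> : (x + y) / 2 - w = ((x - w) + (y - w)) / 2 by field.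
by rewrite cabsf cabs_nat ler_pdivrMr //; have := cabsD (x - w) (y - w); lra.
Qed.

Lemma avg_bound h P M k a b : midclosed P -> (forall x, P x -> N (h x) <= M) ->
  P a -> P b -> N (avg h k a b) <= M.
Proof.
move=> mP hM Pa Pb.
have := @avg_midclosed h P [set x | N (x - 0) <= M] k a b mP (@half_ball _ _).
by rewrite /= subr0; apply => // x /hM; rewrite subr0.
Qed.

Lemma chord_bound h P M k a b : midclosed P -> (forall x, P x -> N (h x) <= M) ->
  P a -> P b -> N (chord h k a b) <= N (b - a) * M.
Proof.
by move=> mP hM Pa Pb; rewrite cabsM ler_wpM2l ?cabs_ge0 //; exact: avg_bound hM _ _.
Qed.

Lemma avg_eq h f P k a b : midclosed P -> (forall x, P x -> h x = f x) ->
  P a -> P b -> avg h k a b = avg f k a b.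
Proof.
move=> mP hf; elim: k a b => [|k IH] a b Pa Pb /=; first by rewrite !hf.
by rewrite !IH //; exact: mP.
Qed.

Lemma avgB h f k a b :
  avg (fun x => h x - f x) k a b = avg h k a b - avg f k a b.
Proof. by elim: k a b => [|k IH] a b /=; rewrite ?IH; field. Qed.

Lemma avgZ h (t : C) k a b : avg (fun x => t * h x) k a b = t * avg h k a b.
Proof. by elim: k a b => [|k IH] a b /=; rewrite ?IH; field. Qed.

Lemma avg_lin (s t : C) w k a b :
  avg (fun x => s + t * (x - w)) k a b = s + t * ((a + b) / 2 - w).
Proof. by elim: k a b => [|k IH] a b /=; rewrite ?IH; field. Qed.

Lemma avg_sym h k a b : avg h k a b = avg h k b a.
Proof.
elim: k a b => [|k IH] a b /=; first by rewrite addrC.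
by rewrite addrC (addrC b a) [avg h k _ b]IH [avg h k a _]IH.
Qed.

Lemma chordB h f k a b :
  chord (fun x => h x - f x) k a b = chord h k a b - chord f k a b.
Proof. by rewrite /chord avgB mulrBr. Qed.

Lemma chordC h k a b : chord h k b a = - chord h k a b.
Proof. by rewrite /chord avg_sym; ring. Qed.

Lemma chordS h k a b :
  chord h k.+1 a b = chord h k a ((a + b) / 2) + chord h k ((a + b) / 2) b.
Proof. by rewrite /chord /=; field. Qed.

Lemma tri_lin (s t : C) w k a b c : tri (fun x => s + t * (x - w)) k a b c = 0.
Proof. by rewrite /tri /chord !avg_lin; field. Qed.

Lemma triB h f k a b c :
  tri (fun x => h x - f x) k a b c = tri h k a b c - tri f k a b c.
Proof. by rewrite /tri !chordB; ring. Qed.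

Lemma triS h k a b c :
  let m := (a + b) / 2 in let n := (b + c) / 2 in let p := (c + a) / 2 in
  tri h k.+1 a b c = tri h k a m p + tri h k m b n + tri h k p n c + tri h k m n p.
Proof.
move=> m n p; rewrite /tri !chordS -/m -/n -/p.
rewrite (chordC h k m p) (chordC h k n p) (chordC h k m n); ring.
Qed.

Definition per a b c := N (b - a) + N (c - b) + N (a - c).

Lemma per_ge0 a b c : 0 <= per a b c.
Proof. by rewrite !addr_ge0 // cabs_ge0. Qed.

Lemma tri_bound h P M k a b c : midclosed P -> (forall x, P x -> N (h x) <= M) ->
  P a -> P b -> P c -> N (tri h k a b c) <= per a b c * M.
Proof.
move=> mP hM Pa Pb Pc; rewrite !mulrDl.
apply: le_trans (cabsD _ _) _; apply: lerD; last exact: chord_bound hM _ _.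
by apply: le_trans (cabsD _ _) _; apply: lerD; apply: chord_bound hM _ _.
Qed.

(** The sums are never shown to converge as [k] grows; bounds for all large [k] add up as limits do,
    and that is all the bisection asks for. *)
Definition eventually_le (T : nat -> C) (r : R) :=
  exists k0, forall k, (k0 <= k)%N -> N (T k) <= r.

Lemma eventually_leD S T r s : eventually_le S r -> eventually_le T s ->
  eventually_le (fun k => S k + T k) (r + s).
Proof.
move=> [i Hi] [j Hj]; exists (maxn i j) => k; rewrite geq_max => /andP[ik jk].
by apply: le_trans (cabsD _ _) _; apply: lerD; [exact: Hi | exact: Hj].
Qed.

Lemma eventually_leS T r : eventually_le (fun k => T k.+1) r -> eventually_le T r.
Proof. by move=> [i Hi]; exists i.+1 => -[//|k] /Hi. Qed.

Lemma eventually_le_trans T r s : r <= s -> eventually_le T r -> eventually_le T s.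
Proof. by move=> rs [i Hi]; exists i => k /Hi h; exact: le_trans rs. Qed.

Lemma per_child a b c :
  let m := (a + b) / 2 in let n := (b + c) / 2 in let p := (c + a) / 2 in
  [/\ per a m p = per a b c / 2, per m b n = per a b c / 2,
      per p n c = per a b c / 2 & per m n p = per a b c / 2].
Proof.
have N2 x y : 2 * x = y -> N x = N y / 2.
  by move=> <-; rewrite cabsM cabs_nat mulrC mulKf // pnatr_eq0.
have N2' x y : 2 * x = - y -> N x = N y / 2 by move=> /N2; rewrite cabsN.
split; rewrite /per.
- rewrite (N2 ((a + b) / 2 - a) (b - a)); last by field.
  rewrite (N2 ((c + a) / 2 - _) (c - b)); last by field.
  by rewrite (N2 (a - (c + a) / 2) (a - c)); [lra | field].
- rewrite (N2 (b - (a + b) / 2) (b - a)); last by field.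
  rewrite (N2 ((b + c) / 2 - b) (c - b)); last by field.
  by rewrite (N2 ((a + b) / 2 - _) (a - c)); [lra | field].
- rewrite (N2 ((b + c) / 2 - _) (b - a)); last by field.
  rewrite (N2 (c - (b + c) / 2) (c - b)); last by field.
  by rewrite (N2 ((c + a) / 2 - c) (a - c)); [lra | field].
- rewrite (N2' ((b + c) / 2 - _) (a - c)); last by field.
  rewrite (N2' ((c + a) / 2 - _) (b - a)); last by field.
  by rewrite (N2' ((a + b) / 2 - _) (c - b)); [lra | field].
Qed.

Definition adherent_closed D :=
  forall x, (forall e : R, 0 < e -> exists2 y, D y & N (y - x) < e) -> D x.

Lemma bernoulli (q : R) n : 0 <= q -> 1 + n%:R * q <= (1 + q) ^+ n.
Proof.
move=> q0; elim: n => [|n IH]; first by rewrite mul0r addr0 expr0.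
have n0 : 0 <= n%:R :> R by rewrite ler0n.
by rewrite exprS -natr1; nra.
Qed.

Lemma geom_big (q M : R) : 1 < q -> exists n, M < q ^+ n.
Proof.
move=> q1; have q0 : 0 < q - 1 by lra.
exists (Num.bound `|M / (q - 1)|).
have := archi_boundP (normr_ge0 (M / (q - 1))); set n := Num.bound _ => hn.
have hM : M / (q - 1) < n%:R by apply: le_lt_trans hn; exact: ler_norm.
move: hM; rewrite ltr_pdivrMr // => hM.
have := @bernoulli (q - 1) n (ltW q0); rewrite (addrC 1 (q - 1)) subrK; lra.
Qed.

Lemma geom_small (p e : R) : 0 < e -> exists n, p / 2 ^+ n < e.
Proof.
move=> e0; have [n Hn] := @geom_big 2 (p / e) (ltr1n R 2).
exists n; move: Hn; rewrite ltr_pdivrMr // => Hn.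
by rewrite ltr_pdivrMr ?exprn_gt0 // mulrC.
Qed.

Lemma halving_limit (u : nat -> C) (p : R) :
  (forall n, N (u n.+1 - u n) <= p / 2 ^+ n) ->
  exists w, forall n, N (u n - w) <= 2 * p / 2 ^+ n.
Proof.
move=> Hu.
have p0 : 0 <= p by have := Hu 0; rewrite expr0 divr1; apply: le_trans; exact: cabs_ge0.
have um n m : N (u (n + m)%N - u n) <= 2 * p / 2 ^+ n - 2 * p / 2 ^+ (n + m).
  elim: m => [|m IH]; first by rewrite addn0 !subrr cabs0.
  rewrite addnS; have := cabs_tri (u (n + m).+1) (u (n + m)%N) (u n).
  move=> /le_trans; apply; have := Hu (n + m)%N.
  have -> : 2 * p / 2 ^+ (n + m).+1 = p / 2 ^+ (n + m).
    by rewrite exprS invfM mulrACA divff ?pnatr_eq0 // mul1r.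
  by move: IH; rewrite -!mulrA; set t := p / 2 ^+ (n + m); lra.
have [|w Hw] := @bolzano_weierstrass _ u (N (u 0) + 2 * p).
  move=> n; have := um 0%N n; rewrite add0n expr0 divr1.
  have := cabs_rev (u n) (u 0).
  have : 0 <= 2 * p / 2 ^+ n by rewrite divr_ge0 ?exprn_ge0 ?mulr_ge0.
  lra.
exists w => n; apply/ler_addgt0Pr => e e0.
have [m nm um'] := Hw e e0 n.
have := um n (m - n)%N; rewrite subnKC // => h.
have h2 : 0 <= 2 * p / 2 ^+ m by rewrite divr_ge0 ?exprn_ge0 ?mulr_ge0.
have := cabs_tri (u n) (u m) w; rewrite (cabsC (u n) (u m)); lra.
Qed.

Section GoursatTriangle.
Variables (h : C -> C) (D : set C).
Hypotheses (mD : midclosed D) (cD : adherent_closed D).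
Hypothesis hD : forall x, D x -> exists l, isD h x l.

Let bad (eta : R) (t : C * C * C) := let: (a, b, c) := t in
  [/\ D a, D b, D c &
   ~ eventually_le (fun k => tri h k a b c) (eta * per a b c ^+ 2)].

(** A child has half the perimeter, hence a quarter of the allowance; if all four children met
    theirs, the parent would meet its own. The last clause makes the first vertices of nested bad
    triangles converge. *)
Lemma bad_child eta t : bad eta t -> exists t', [/\ bad eta t',
  per t'.1.1 t'.1.2 t'.2 = per t.1.1 t.1.2 t.2 / 2 &
  N (t'.1.1 - t.1.1) <= per t.1.1 t.1.2 t.2].
Proof.
case: t => [[a b] c] /= [Da Db Dc nE].
have [] := per_child a b c.
set m := (a + b) / 2; set n := (b + c) / 2; set p := (c + a) / 2.
move=> p1 p2 p3 p4; set q := per a b c.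
have [Dm Dn Dp] : [/\ D m, D n & D p] by split; exact: mD.
have q1 : N (b - a) <= q by have := cabs_ge0 (c - b); have := cabs_ge0 (a - c); rewrite /q /per; lra.
have q2 : N (a - c) <= q by have := cabs_ge0 (c - b); have := cabs_ge0 (b - a); rewrite /q /per; lra.
have h2 x y : N ((x + y) / 2 - x) = N (y - x) / 2.
  by have -> : (x + y) / 2 - x = (y - x) / 2; [field | rewrite cabsf cabs_nat].
have dm : N (m - a) <= q by rewrite h2; have := cabs_ge0 (b - a); lra.
have dp : N (p - a) <= q by rewrite /p (addrC c) h2 cabsC; have := cabs_ge0 (a - c); lra.
have q0 : 0 <= q by exact: per_ge0.
apply: contrapT => nex.
have good x y z : D x -> D y -> D z -> per x y z = q / 2 -> N (x - a) <= q ->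
    eventually_le (fun k => tri h k x y z) (eta * q ^+ 2 / 4).
  move=> Dx Dy Dz pq xa; apply: contrapT => nE'.
  apply: nex; exists (x, y, z); split=> //=; split=> //.
  have -> // : eta * per x y z ^+ 2 = eta * q ^+ 2 / 4 by rewrite pq; field.
apply: nE; apply: eventually_leS.
have -> : (fun k => tri h k.+1 a b c) = fun k =>
   tri h k a m p + tri h k m b n + tri h k p n c + tri h k m n p.
  by apply/funext => k; exact: triS.
have -> : eta * per a b c ^+ 2 = eta * q ^+ 2 / 4 + eta * q ^+ 2 / 4 +
  eta * q ^+ 2 / 4 + eta * q ^+ 2 / 4 by rewrite -/q; field.
apply: eventually_leD; first apply: eventually_leD; first apply: eventually_leD.
- by apply: good => //; rewrite subrr cabs0.
- exact: good.
- exact: good.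
- exact: good.
Qed.

Lemma goursat a b c (e : R) : D a -> D b -> D c -> 0 < e ->
  eventually_le (fun k => tri h k a b c) e.
Proof.
move=> Da Db Dc e0; set p := per a b c; have p0 : 0 <= p by exact: per_ge0.
have p20 : 0 <= p ^+ 2 by exact: sqr_ge0.
set eta := e / (p ^+ 2 + 1); have eta0 : 0 < eta by rewrite divr_gt0 //; lra.
have : eta * p ^+ 2 <= e by rewrite /eta mulrAC ler_pdivrMr; nra.
move=> /eventually_le_trans; apply; apply: contrapT => nE.
have b0 : bad eta (a, b, c) by split.
have H t : exists t', bad eta t -> [/\ bad eta t',
    per t'.1.1 t'.1.2 t'.2 = per t.1.1 t.1.2 t.2 / 2 &
    N (t'.1.1 - t.1.1) <= per t.1.1 t.1.2 t.2].
  by case: (pselect (bad eta t)) => [/bad_child[t' ?]|nb]; [exists t' | exists t].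
have [F HF] := choice H.
pose T n := iter n F (a, b, c).
have bT n : bad eta (T n) by elim: n => [|n IH] //; have [] := HF _ IH.
have pT n : per (T n).1.1 (T n).1.2 (T n).2 = p / 2 ^+ n.
  elim: n => [|n IH]; first by rewrite expr0 divr1.
  by have [_ -> _] := HF _ (bT n); rewrite IH exprSr invfM mulrA.
have [|w Hw] := @halving_limit (fun n => (T n).1.1) p.
  by move=> n; have [_ _] := HF _ (bT n); rewrite pT.
have Dw : D w.
  apply: cD => d d0; have [n Hn] := geom_small (2 * p) d0.
  exists (T n).1.1; first by have := bT n; case: (T n) => [[? ?] ?] [].
  exact: le_lt_trans (Hw n) Hn.
have [l /isDP Hl] := hD Dw.
(* The first vertex is within [2 * pn] of [w], the others within [3 * pn]. With slack [eta / 3] the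
   deviation from an affine function is at most [eta * pn] on that disk, and [pn] is the
   perimeter. *)
have eta30 : 0 < eta / 3 by rewrite divr_gt0.
have [d d0 Hd] := Hl _ eta30; have [n Hn] := geom_small (3 * p) d0.
have := bT n; have := pT n; have := Hw n.
case: (T n) => [[a' b'] c'] /=; set pn := p / 2 ^+ n => aw pE [Da' Db' Dc' nE'].
have {}aw : N (a' - w) <= 2 * pn by rewrite /pn mulrA.
have {}Hn : 3 * pn < d by rewrite /pn mulrA.
have pn0 : 0 <= pn by rewrite -pE per_ge0.
have ab : N (b' - a') <= pn by rewrite -pE /per; have := cabs_ge0 (c' - b'); have := cabs_ge0 (a' - c'); lra.
have ac : N (c' - a') <= pn by rewrite cabsC -pE /per; have := cabs_ge0 (c' - b'); have := cabs_ge0 (b' - a'); lra.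
apply: nE'; exists 0%N => k _.
have -> : tri h k a' b' c' = tri (fun x => h x - (h w + l * (x - w))) k a' b' c'.
  by rewrite triB tri_lin subr0.
have -> : eta * per a' b' c' ^+ 2 = per a' b' c' * (eta / 3 * (3 * pn)).
  by rewrite pE; field.
apply: (tri_bound (P := [set x | N (x - w) <= 3 * pn])).
- exact: half_ball.
- move=> x /= xw; rewrite opprD addrA.
  apply: le_trans (Hd _ _) _; first exact: le_lt_trans Hn.
  by rewrite ler_wpM2l // ltW.
- by rewrite /=; lra.
- by have := cabs_tri b' a' w; rewrite /=; lra.
- by have := cabs_tri c' a' w; rewrite /=; lra.
Qed.

End GoursatTriangle.

Lemma bounded_on_ball h c (r : R) : (forall x, N (x - c) <= r -> ctsat h x) ->
  exists2 M, 0 < M & forall x, N (x - c) <= r -> N (h x) <= M.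
Proof.
move=> ch; apply: contrapT => nb.
have H n : exists x, N (x - c) <= r /\ n%:R < N (h x).
  apply: contrapT => nx; apply: nb; exists (n%:R + 1); first by rewrite ltr_wpDl.
  move=> x xr; rewrite leNgt; apply/negP => hx; apply: nx; exists x; split => //.
  by move: hx; lra.
have [u Hu] := choice H.
have [|w Hw] := @bolzano_weierstrass _ u (N c + r).
  by move=> n; have := cabs_rev (u n) c; have [] := Hu n; lra.
have wr : N (w - c) <= r.
  apply/ler_addgt0Pr => e e0; have [m _ hm] := Hw e e0 0%N.
  have := cabs_tri w (u m) c; rewrite (cabsC w (u m)); have [] := Hu m; lra.
have [d d0 Hd] := ch _ wr 1 ltr01.
have [m nm um] := Hw d d0 (Num.bound `|N (h w) + 1|).
have [_] := Hu m; have := Hd _ um; have := cabs_rev (h (u m)) (h w).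
have := archi_boundP (normr_ge0 (N (h w) + 1)); have := ler_norm (N (h w) + 1).
have : (Num.bound `|N (h w) + 1|)%:R <= m%:R :> R by rewrite ler_nat.
lra.
Qed.

Lemma dslope_isD_off f z l x m : x != z -> isD f x m ->
  exists m', isD (dslope f z l) x m'.
Proof.
move=> xz fx; exists (m * (x - z)^-1 + (f x - f z) * (- 1 / (x - z) ^+ 2)).
have d0 : 0 < N (x - z) by rewrite cabs_gt0 subr_eq0.
apply: (isD_near (f := fun y => (f y - f z) * (y - z)^-1) d0).
  move=> y yx; rewrite /dslope; case: (eqVneq y z) => // yz.
  by move: yx; rewrite yz cabsC ltxx.
apply: isDM.
  by rewrite -[m]subr0; apply: isDB => //; exact: isD_cst.
apply: isDV; first by rewrite subr_eq0.
by rewrite -[X in isD _ _ X](subr0 1); apply: isDB; [exact: isD_id | exact: isD_cst].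
Qed.

End Goursat.

(** * The Cauchy estimate on a diamond and the maximum principle *)

Section MaximumPrinciple.
Variable R : realType.
Local Notation C := (cplx R).
Local Notation N := (@cabs R).
Implicit Types (x y z w a b c : C) (f h : C -> C) (k n : nat).

(** At the vertex [z] only boundedness of [h] is available. Bisection cuts off three triangles on
    which [l] is bounded away from 0, where Goursat applies, and leaves one at [z] of half the
    perimeter; after [n] rounds its contribution is of order [2 ^- n]. *)
Lemma tri_vertex h z c (rho K : R) (l : C -> R) :
  (forall x y, l ((x + y) / 2) = (l x + l y) / 2) ->
  (forall x y, l x - l y <= 2 * N (x - y)) -> l z = 0 ->
  N (z - c) <= rho -> (forall x, N (x - c) <= rho -> N (h x) <= K) ->
  (forall x, N (x - c) <= rho -> 0 < l x -> exists m, isD h x m) ->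
  forall n a b (e : R), N (a - c) <= rho -> N (b - c) <= rho ->
    0 < l a -> 0 < l b -> 0 < e ->
  eventually_le (fun k => tri h k z a b) (per z a b * K / 2 ^+ n + e).
Proof.
move=> lmid llip lz zc hK hD; elim=> [|n IH] a b e ac bc la lb e0.
  exists 0%N => k _; rewrite expr0 divr1.
  apply: le_trans (tri_bound k (half_ball (w := c) (r := rho)) hK zc ac bc) _.
  lra.
have [] := per_child z a b; set p := (z + a) / 2; set q := (a + b) / 2.
set s := (b + z) / 2 => per1 _ _ _.
have pc : N (p - c) <= rho by exact: half_ball.
have qc : N (q - c) <= rho by exact: half_ball.
have sc : N (s - c) <= rho by exact: half_ball.
(* Half the minimum, because [l] halves at the midpoints [p] and [s] of the sides through [z]. The
   weak inequality in [D] keeps [D] closed. *)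
pose eta := Num.min (l a) (l b) / 2.
have eta0 : 0 < eta by rewrite divr_gt0 // lt_min la.
have eta1 : eta <= l a / 2 by rewrite ler_pM2r ?invr_gt0 // ge_min lexx.
have eta2 : eta <= l b / 2 by rewrite ler_pM2r ?invr_gt0 // ge_min lexx orbT.
pose D := [set x | N (x - c) <= rho /\ eta <= l x].
have mD : midclosed D.
  by move=> x y [xc xe] [yc ye]; split; [exact: half_ball | rewrite lmid; lra].
have cD : adherent_closed D.
  move=> x Hx; split; apply/ler_addgt0Pr => d d0.
    by have [y [yc _] yx] := Hx d d0; have := cabs_tri x y c; rewrite (cabsC x y); lra.
  have d20 : 0 < d / 2 by rewrite divr_gt0.
  by have [y [_ yl] yx] := Hx _ d20; have := llip y x; lra.
have gD := @goursat _ h D mD cD (fun x Hx => hD x Hx.1 (lt_le_trans eta0 Hx.2)).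
have Da : D a by split => //; lra.
have Db : D b by split => //; lra.
have Dp : D p by split => //; rewrite lmid lz; lra.
have Dq : D q by split => //; rewrite lmid; lra.
have Ds : D s by split => //; rewrite lmid lz; lra.
have e6 : 0 < e / 4 by rewrite divr_gt0.
apply: eventually_leS.
have -> : (fun k => tri h k.+1 z a b) = fun k =>
   tri h k z p s + tri h k p a q + tri h k s q b + tri h k p q s.
  by apply/funext => k; exact: triS.
have -> : per z a b * K / 2 ^+ n.+1 + e = (per z p s * K / 2 ^+ n + e / 4)
   + e / 4 + e / 4 + e / 4.
  by rewrite per1 exprS invfM; set t := (2 ^+ n)^-1; field.
apply: eventually_leD; first apply: eventually_leD; first apply: eventually_leD.
- by apply: IH => //; rewrite lmid lz; lra.
- exact: gD.
- exact: gD.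
- exact: gD.
Qed.

Definition re z : R := complex.Re z.
Definition im z : R := complex.Im z.

Lemma reD z w : re (z + w) = re z + re w. Proof. by case: z w => ? ? []. Qed.
Lemma imD z w : im (z + w) = im z + im w. Proof. by case: z w => ? ? []. Qed.
Lemma reN z : re (- z) = - re z. Proof. by case: z. Qed.
Lemma imN z : im (- z) = - im z. Proof. by case: z. Qed.
Lemma reMr (t : R) z : re (rc t * z) = t * re z.
Proof. by case: z => a b; rewrite /re /rc /= mul0r subr0. Qed.
Lemma imMr (t : R) z : im (rc t * z) = t * im z.
Proof. by case: z => a b; rewrite /im /rc /= mul0r addr0. Qed.

Lemma half_rc z : z / 2 = rc 2^-1 * z.
Proof. by rewrite rcV rc_nat mulrC. Qed.

Lemma sqr_cabs z : N z ^+ 2 = re z ^+ 2 + im z ^+ 2.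
Proof. by case: z => a b; rewrite /cabs /re /im /= sqr_sqrtr // addr_ge0 ?sqr_ge0. Qed.

Lemma re_cabs z : `|re z| <= N z.
Proof. by rewrite -ler_sqr ?nnegrE ?cabs_ge0 // real_normK ?num_real // sqr_cabs lerDl sqr_ge0. Qed.

Lemma im_cabs z : `|im z| <= N z.
Proof. by rewrite -ler_sqr ?nnegrE ?cabs_ge0 // real_normK ?num_real // sqr_cabs lerDr sqr_ge0. Qed.

Lemma im_div z w : im (z / w) = (re w * im z - im w * re z) / N w ^+ 2.
Proof.
rewrite sqr_cabs; case: z w => a b [c d]; rewrite /re /im /=.
by rewrite mulrBl !mulrA; ring.
Qed.

Section Diamond.
Variables (c z : C) (r : R).
Hypothesis zr : N (z - c) < r / 2.

(** The diamond has its vertices at distance [rho] from [c] and its edges at distance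
    [rho / sqrt 2]. As 3/4 < 1 and 3/4 > 1 / sqrt 2, the edges lie in the annulus between [r / 2]
    and [r]. The number [mu] measures how far inside [z] lies, in the sum norm. *)
Let rho := 3 / 4 * r.
Let mu := rho - `|re (z - c)| - `|im (z - c)|.

Let r0 : 0 < r.
Proof. by have := cabs_ge0 (z - c); move: zr; lra. Qed.

Let mu0 : 0 < mu.
Proof.
have := sqr_cabs (z - c); rewrite -(real_normK (num_real (re _))).
rewrite -(real_normK (num_real (im _))) /mu /rho.
have := cabs_ge0 (z - c).
have := normr_ge0 (re (z - c)); have := normr_ge0 (im (z - c)).
move: zr; set s := `|re _|; set t := `|im _|; set u := N _; have := r0.
move=> rp zr' t0 s0 u0 e; rewrite -addrA -opprD subr_gt0.
rewrite -ltr_sqr ?nnegrE; [|lra|lra].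
have := sqr_ge0 (s - t); nra.
Qed.

(* The four edges of the diamond are the sets [s re (x - c) + t im (x - c) = rho]
   with [s, t = 1, -1]. *)
Section Edge.
Variables (s t : R) (a b : C).
Hypotheses (s1 : `|s| = 1) (t1 : `|t| = 1).
Hypotheses (ac : N (a - c) <= rho) (bc : N (b - c) <= rho).
Hypothesis al : s * re (a - c) + t * im (a - c) = rho.
Hypothesis bl : s * re (b - c) + t * im (b - c) = rho.
Hypotheses (abr : re (b - a) = - rho * t) (abi : im (b - a) = rho * s).

Let P := [set x | N (x - c) <= rho /\ rho <= s * re (x - c) + t * im (x - c)].

Let Pa : P a. Proof. by split => //; rewrite al. Qed.
Let Pb : P b. Proof. by split => //; rewrite bl. Qed.

Let lin (w : C) x := s * re (x - w) + t * im (x - w).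

Let lin_half w x y : lin w ((x + y) / 2) = (lin w x + lin w y) / 2.
Proof.
rewrite /lin !half_rc !(reD, imD, reN, imN) !(reMr, imMr) !(reD, imD).
by field.
Qed.

Let lin_le w x : lin w x <= `|re (x - w)| + `|im (x - w)|.
Proof.
apply: le_trans (ler_norm _) _; apply: le_trans (ler_normD _ _) _.
by rewrite !normrM s1 t1 !mul1r.
Qed.

Let lin_lip w x y : lin w x - lin w y <= 2 * N (x - y).
Proof.
have -> : lin w x - lin w y = lin y x by rewrite /lin !(reD, imD, reN, imN); ring.
by apply: le_trans (lin_le _ _) _; have := re_cabs (x - y); have := im_cabs (x - y); lra.
Qed.

Let lin_z x : lin c x - (`|re (z - c)| + `|im (z - c)|) <= lin z x.
Proof.
have -> : lin z x = lin c x - lin c z by rewrite /lin !(reD, imD, reN, imN); ring.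
by have := lin_le c z; lra.
Qed.

Lemma edge_midclosed : midclosed P.
Proof.
move=> x y [xc xl] [yc yl]; split; first exact: half_ball.
by have := lin_half c x y; rewrite /lin; lra.
Qed.

Lemma edge_far x : P x -> r / 2 <= N (x - c).
Proof.
move=> [_ xl]; have := lin_le c x; rewrite /lin => xl'.
have := sqr_cabs (x - c); rewrite -(real_normK (num_real (re _))).
rewrite -(real_normK (num_real (im _))).
rewrite -ler_sqr ?nnegrE ?cabs_ge0; [|have := r0; lra|by []].
have := normr_ge0 (re (x - c)); have := normr_ge0 (im (x - c)).
move: xl xl'; rewrite /rho; set u := `|re _|; set v := `|im _|; have := r0.
move=> rp xl xl' v0 u0 ->.
have : (3 / 4 * r) ^+ 2 <= (u + v) ^+ 2 by rewrite ler_sqr ?nnegrE; lra.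
have := sqr_ge0 (u - v); nra.
Qed.

(** [lin z] vanishes at [z] and is positive at both ends of the edge, so it separates the vertex [z]
    from the rest of the triangle as [tri_vertex] requires. *)
Lemma edge_tri f (l : C) (e : R) : (forall x, N (x - c) < r -> exists m, isD f x m) ->
  isD f z l -> 0 < e -> eventually_le (fun k => tri (dslope f z l) k z a b) e.
Proof.
move=> fD fz e0; have rr : rho < r by rewrite /rho; have := r0; lra.
have zc : N (z - c) <= rho by rewrite /rho; have := r0; move: zr; lra.
have [K K0 hK] : exists2 K, 0 < K & forall x, N (x - c) <= rho -> N (dslope f z l x) <= K.
  apply: bounded_on_ball => x xc; have [xz|xz] := eqVneq x z.
    by rewrite xz; exact: isD_dslope.
  have [m fx] := fD _ (le_lt_trans xc rr).
  by have [m' /isD_cts] := dslope_isD_off l xz fx.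
have e20 : 0 < e / 2 by rewrite divr_gt0.
have [n Hn] := geom_small (per z a b * K) e20.
apply: eventually_le_trans (_ : per z a b * K / 2 ^+ n + e / 2 <= e) _; first lra.
apply: (@tri_vertex _ _ c rho K (lin z)) => //.
- by rewrite /lin subrr /re /im /= !mulr0 addr0.
- move=> x xc lx; have [m fx] := fD _ (le_lt_trans xc rr).
  apply: dslope_isD_off fx; apply: contraTneq lx => ->.
  by rewrite /lin subrr /re /im /= !mulr0 addr0 ltxx.
- by have := lin_z a; have := mu0; rewrite /mu [lin c a]/lin al; lra.
- by have := lin_z b; have := mu0; rewrite /mu [lin c b]/lin bl; lra.
Qed.

(** Since [b - a] is [rho] times i (s + i t), this imaginary part is
    [rho * lin z x / N (x - z) ^+ 2]: the speed at which the argument of [x - z] grows along the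
    edge. *)
Lemma edge_kernel x : P x -> rho * mu / (2 * r) ^+ 2 <= im ((b - a) / (x - z)).
Proof.
move=> [xc xl]; rewrite im_div abr abi.
have -> : re (x - z) * (rho * s) - im (x - z) * (- rho * t) = rho * lin z x.
  by rewrite /lin; ring.
have xz : mu <= lin z x by have := lin_z x; rewrite /mu [lin c x]/lin; lra.
have rho0 : 0 < rho by rewrite /rho; have := r0; lra.
have xz0 : 0 < N (x - z).
  have := lin_lip z x z; have -> : lin z z = 0.
    by rewrite /lin subrr /re /im /= !mulr0 addr0.
  by have := mu0; lra.
have xz1 : N (x - z) <= 2 * r.
  by have := cabs_tri x c z; rewrite (cabsC c z); move: xc zr r0; rewrite /rho; lra.
apply: ler_pM.
- by rewrite mulr_ge0 // ltW // mu0.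
- by rewrite invr_ge0 sqr_ge0.
- by rewrite ler_pM2l.
- have r20 : 0 < 2 * r by rewrite mulr_gt0 ?r0.
  by rewrite lef_pV2 ?posrE ?exprn_gt0 // ler_sqr ?nnegrE // ltW.
Qed.

Lemma edge_chord k : rho * mu / (2 * r) ^+ 2 <= im (chord (fun x => (x - z)^-1) k a b).
Proof.
rewrite /chord -avgZ.
have := @avg_midclosed _ (fun x => (b - a) * (x - z)^-1) P
  [set w | rho * mu / (2 * r) ^+ 2 <= im w] k a b edge_midclosed.
apply => //; last by move=> x /edge_kernel.
by move=> x y /= hx hy; rewrite half_rc imMr imD; lra.
Qed.

Lemma edge_estimate f (M : R) k :
  (forall x, r / 2 <= N (x - c) < r -> N (f x) <= M) ->
  N (chord (fun x => f x / (x - z)) k a b) <= 2 * rho * M / (r / 2 - N (z - c)).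
Proof.
move=> fM; have rr : rho < r by rewrite /rho; have := r0; lra.
have nu0 : 0 < r / 2 - N (z - c) by move: zr; lra.
have hP x : P x -> N (f x / (x - z)) <= M / (r / 2 - N (z - c)).
  move=> Px; have xf := edge_far Px; have xc := Px.1.
  have xz : r / 2 - N (z - c) <= N (x - z).
    have -> : x - z = x - c - (z - c) by ring.
    by have := cabs_rev (x - c) (z - c); lra.
  rewrite cabsf; apply: ler_pM; rewrite ?cabs_ge0 ?invr_ge0 ?cabs_ge0 //.
    by apply: fM; rewrite xf; apply: le_lt_trans xc rr.
  by rewrite lef_pV2 ?posrE //; exact: lt_le_trans xz.
apply: le_trans (chord_bound k edge_midclosed hP Pa Pb) _.
have M0 : 0 <= M / (r / 2 - N (z - c)) by apply: le_trans (hP _ Pa); exact: cabs_ge0.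
rewrite -mulrA; apply: ler_wpM2r => //.
by have := cabs_tri b c a; rewrite (cabsC c a); move: ac bc; lra.
Qed.

Lemma edge_neq x : P x -> x != z.
Proof.
by move=> /edge_far; apply: contraTneq => ->; rewrite -ltNge.
Qed.

Lemma edge_dslope f (l : C) k : chord (dslope f z l) k a b =
  chord (fun x => f x / (x - z)) k a b - f z * chord (fun x => (x - z)^-1) k a b.
Proof.
rewrite /chord (avg_eq (f := fun x => f x / (x - z) - f z * (x - z)^-1) k
  edge_midclosed _ Pa Pb) ?avgB ?avgZ; first by ring.
by move=> x /edge_neq/negbTE xz; rewrite /dslope xz mulrBl.
Qed.

End Edge.

Let pt (u v : R) : C := c + Complex u v.

Let ptc u v : pt u v - c = Complex u v.
Proof. by rewrite /pt addrC addKr. Qed.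

Let pt_rho u v : u ^+ 2 + v ^+ 2 = rho ^+ 2 -> N (pt u v - c) <= rho.
Proof.
have rho0 : 0 < rho by rewrite /rho; have := r0; lra.
move=> uv; rewrite ptc -ler_sqr ?nnegrE ?cabs_ge0 //; last exact: ltW.
by rewrite sqr_cabs /re /im /= uv.
Qed.

(** In the sum over the four triangles with apex [z] the inner sides cancel. What is left compares
    [f z] times the kernel sums, whose total imaginary part is at least [4 * ka], with four boundary
    sums of [f], up to an arbitrarily small error. Both bounds count four edges, so the factors 4
    cancel in [A]. *)
Lemma cauchy_estimate : exists2 A : R, 0 < A & forall f (M : R),
  (forall x, N (x - c) < r -> exists m, isD f x m) ->
  (forall x, r / 2 <= N (x - c) < r -> N (f x) <= M) -> N (f z) <= A * M.
Proof.
have rho0 : 0 < rho by rewrite /rho; have := r0; lra.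
set nu := r / 2 - N (z - c); have nu0 : 0 < nu by rewrite /nu; move: zr; lra.
set ka := rho * mu / (2 * r) ^+ 2.
have ka0 : 0 < ka by apply: divr_gt0;
  [exact: mulr_gt0 rho0 mu0 | apply: exprn_gt0; exact: mulr_gt0 _ r0].
exists (2 * rho / nu / ka); first by apply: divr_gt0 => //; apply: divr_gt0 => //; exact: mulr_gt0.
move=> f M fD fM.
have [l fz] : exists l, isD f z l by apply: fD; move: zr (r0); lra.
rewrite mulrAC ler_pdivlMr //; apply/ler_addgt0Pr => e e0.
have n1 : `|1 : R| = 1 by rewrite normr1.
have nN1 : `|- 1 : R| = 1 by rewrite normrN1.
have ev (s t : R) (u v u' v' : R) : `|s| = 1 -> `|t| = 1 ->
    u ^+ 2 + v ^+ 2 = rho ^+ 2 -> u' ^+ 2 + v' ^+ 2 = rho ^+ 2 ->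
    s * u + t * v = rho -> s * u' + t * v' = rho ->
    u' - u = - rho * t -> v' - v = rho * s ->
    let a := pt u v in let b := pt u' v' in
    [/\ eventually_le (fun k => tri (dslope f z l) k z a b) e,
      forall k, chord (dslope f z l) k a b = chord (fun x => f x / (x - z)) k a b
          - f z * chord (fun x => (x - z)^-1) k a b,
      forall k, N (chord (fun x => f x / (x - z)) k a b) <= 2 * rho * M / nu &
      forall k, ka <= im (chord (fun x => (x - z)^-1) k a b)].
  move=> s1 t1 /pt_rho h1 /pt_rho h2 h3 h4 h5 h6 a b.
  have al : s * re (a - c) + t * im (a - c) = rho by rewrite ptc.
  have bl : s * re (b - c) + t * im (b - c) = rho by rewrite ptc.
  have ba : b - a = Complex (u' - u) (v' - v).
    by rewrite /a /b /pt opprD addrACA subrr add0r.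
  have abr : re (b - a) = - rho * t by rewrite ba.
  have abi : im (b - a) = rho * s by rewrite ba.
  split.
  - exact: (edge_tri s1 t1 h1 h2 al bl).
  - by move=> k; exact: (edge_dslope s1 t1 h1 h2 al bl).
  - by move=> k; exact: (edge_estimate s1 t1 h1 h2 al bl).
  - by move=> k; exact: (edge_chord s1 t1 h1 h2 al bl abr abi).
have [[k0 E0] D0 F0 K0] := ev 1 1 rho 0 0 rho n1 n1 ltac:(ring) ltac:(ring)
  ltac:(ring) ltac:(ring) ltac:(ring) ltac:(ring).
have [[k1 E1] D1 F1 K1] := ev (-1) 1 0 rho (- rho) 0 nN1 n1 ltac:(ring) ltac:(ring)
  ltac:(ring) ltac:(ring) ltac:(ring) ltac:(ring).
have [[k2 E2] D2 F2 K2] := ev (-1) (-1) (- rho) 0 0 (- rho) nN1 nN1 ltac:(ring)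
  ltac:(ring) ltac:(ring) ltac:(ring) ltac:(ring) ltac:(ring).
have [[k3 E3] D3 F3 K3] := ev 1 (-1) 0 (- rho) rho 0 n1 nN1 ltac:(ring) ltac:(ring)
  ltac:(ring) ltac:(ring) ltac:(ring) ltac:(ring).
pose k := (k0 + k1 + k2 + k3)%N.
move: {E0}(E0 k ltac:(rewrite /k; lia)) {E1}(E1 k ltac:(rewrite /k; lia)).
move: {E2}(E2 k ltac:(rewrite /k; lia)) {E3}(E3 k ltac:(rewrite /k; lia)).
move: {F0}(F0 k) {F1}(F1 k) {F2}(F2 k) {F3}(F3 k).
move: {K0}(K0 k) {K1}(K1 k) {K2}(K2 k) {K3}(K3 k).
move: {D0}(D0 k) {D1}(D1 k) {D2}(D2 k) {D3}(D3 k); rewrite /tri.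
set p0 := pt rho 0; set p1 := pt 0 rho; set p2 := pt (- rho) 0; set p3 := pt 0 (- rho).
move=> -> -> -> ->; rewrite !(chordC _ _ z).
set q0 := chord _ k z p0; set q1 := chord _ k z p1.
set q2 := chord _ k z p2; set q3 := chord _ k z p3.
set K0 := chord _ k p0 p1; set K1 := chord _ k p1 p2.
set K2 := chord _ k p2 p3; set K3 := chord _ k p3 p0.
set F0 := chord _ k p0 p1; set F1 := chord _ k p1 p2.
set F2 := chord _ k p2 p3; set F3 := chord _ k p3 p0.
set E0 := q0 + _ - q1; set E1 := q1 + _ - q2.
set E2 := q2 + _ - q3; set E3 := q3 + _ - q0.
move=> hK0 hK1 hK2 hK3 hF0 hF1 hF2 hF3 hE0 hE1 hE2 hE3.
have key : f z * (K0 + K1 + K2 + K3) = F0 + F1 + F2 + F3 - (E0 + E1 + E2 + E3).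
  by rewrite /E0 /E1 /E2 /E3; ring.
have hK : 4 * ka <= N (K0 + K1 + K2 + K3).
  apply: le_trans (im_cabs _); apply: le_trans (ler_norm _).
  by rewrite !imD; lra.
have sum4 (u0 u1 u2 u3 : C) (t : R) : N u0 <= t -> N u1 <= t -> N u2 <= t ->
    N u3 <= t -> N (u0 + u1 + u2 + u3) <= 4 * t.
  have := cabsD (u0 + u1 + u2) u3; have := cabsD (u0 + u1) u2; have := cabsD u0 u1.
  lra.
have hF := sum4 _ _ _ _ _ hF0 hF1 hF2 hF3; have hE := sum4 _ _ _ _ _ hE2 hE3 hE0 hE1.
have := cabsB (F0 + F1 + F2 + F3) (E0 + E1 + E2 + E3); rewrite -key cabsM => h.
have h2 : N (f z) * (4 * ka) <= N (f z) * N (K0 + K1 + K2 + K3).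
  by rewrite ler_wpM2l ?cabs_ge0.
have -> : 2 * rho / nu * M = 2 * rho * M / nu by rewrite mulrAC.
lra.
Qed.

End Diamond.
(** If [v] exceeded [M], the powers of [v / M] would outgrow [B / k]. So a multiplicative constant
    costs nothing in a bound valid for all powers. *)
Lemma le_of_powers (k B v M : R) : 0 < k -> 0 <= M -> 0 <= v ->
  (forall n, k * v ^+ n <= B * M ^+ n) -> v <= M.
Proof.
move=> k0 M0 v0 H; rewrite leNgt; apply/negP => Mv.
have [Mz|Mn] := eqVneq M 0.
  have := H 1%N; rewrite !expr1 Mz mulr0 leNgt mulr_gt0 //.
  exact: le_lt_trans M0 Mv.
have Mp : 0 < M by rewrite lt_neqAle eq_sym Mn.
have q1 : 1 < v / M by rewrite ltr_pdivlMr // mul1r.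
have [n] := geom_big (B / k) q1; rewrite expr_div_n ltr_pdivrMr // => Hn.
have Mn0 : 0 < M ^+ n by rewrite exprn_gt0.
have : B * M ^+ n < v ^+ n * k.
  by move: Hn; rewrite -(ltr_pM2r Mn0) mulrAC divfK // gt_eqF.
by rewrite ltNge (mulrC (v ^+ n)) H.
Qed.

(** Caratheodory's form with slope [h]: a linear factor turns continuity at an exceptional point
    into derivability. *)
Lemma isD_mul_zero h z : ctsat h z -> isD (fun x => (x - z) * h x) z (h z).
Proof. by move=> hz; exists h; split=> // x; rewrite subrr mul0r subr0 mulrC. Qed.

Lemma avoid_point z w (d : R) : 0 < d -> exists2 d', 0 < d' <= d &
  forall x, 0 < N (x - z) < d' -> x != w.
Proof.
move=> d0; have [->|zw] := eqVneq z w.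
  exists d => [|x]; first by rewrite d0 lexx.
  by rewrite cabs_gt0 subr_eq0 => /andP[].
exists (Num.min d (N (z - w))) => [|x].
  by rewrite lt_min d0 cabs_gt0 subr_eq0 zw ge_min lexx.
rewrite lt_min => /and3P[_ _]; apply: contraTneq => ->.
by rewrite (cabsC w) ltxx.
Qed.

(* Applying the Cauchy estimate to [(x - e1) (x - e2) f ^ n] and letting n grow
   removes both the constant and the exceptional points. *)
Lemma max_principle f c (r M : R) e1 e2 : 0 <= M ->
  (forall x, N (x - c) < r -> ctsat f x) ->
  (forall x, N (x - c) < r -> x != e1 -> x != e2 -> exists m, isD f x m) ->
  (forall x, r / 2 <= N (x - c) < r -> N (f x) <= M) ->
  forall z, N (z - c) < r -> N (f z) <= M.
Proof.
move=> M0 cf fD fM.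
have off z : N (z - c) < r / 2 -> z != e1 -> z != e2 -> N (f z) <= M.
  move=> zc ze1 ze2; have [A A0 HA] := cauchy_estimate zc.
  have r0 : 0 < r by have := cabs_ge0 (z - c); move: zc; lra.
  apply: (@le_of_powers (N (z - e1) * N (z - e2))
    (A * ((r + N (c - e1)) * (r + N (c - e2)))) _ _ _ M0 (cabs_ge0 _)) => [|n].
    by rewrite mulr_gt0 // cabs_gt0 subr_eq0.
  rewrite -cabsX -!cabsM -mulrA.
  rewrite -[A * _ * _]mulrA.
  apply: (HA (fun x => (x - e1) * ((x - e2) * f x ^+ n))) => x.
    move=> xc.
    have cfn y : N (y - c) < r -> ctsat (fun x => f x ^+ n) y.
      move=> /cf fy; elim: (n) => [|m IH].
        have -> : (fun x => f x ^+ 0) = fun=> 1 by apply/funext => t; rewrite expr0.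
        exact: cts_cst.
      have -> : (fun x => f x ^+ m.+1) = fun x => f x * f x ^+ m.
        by apply/funext => t; rewrite exprS.
      exact: ctsM.
    have cs e : ctsat (fun x => x - e) x.
      by apply: ctsB; [exact: cts_id | exact: cts_cst].
    have ds e : isD (fun x => x - e) x 1.
      by rewrite -[X in isD _ _ X](subr0 1); apply: isDB; [exact: isD_id | exact: isD_cst].
    have [xe1|xe1] := eqVneq x e1.
      rewrite -xe1; eexists; apply: isD_mul_zero.
      by apply: ctsM => //; exact: cfn.
    have [xe2|xe2] := eqVneq x e2.
      rewrite -xe2; have -> : (fun x0 => (x0 - e1) * ((x0 - x) * f x0 ^+ n)) =
        fun x0 => (x0 - x) * ((x0 - e1) * f x0 ^+ n) by apply/funext => t; ring.
      eexists; apply: isD_mul_zero.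
      by apply: ctsM => //; exact: cfn.
    have [m fx] := fD _ xc xe1 xe2; have [m' fnx] := isDX n fx.
    by eexists; exact: isDM (ds _) (isDM (ds _) fnx).
  move=> /andP[xc1 xc2]; rewrite !cabsM cabsX mulrA.
  have h e : N (x - e) <= r + N (c - e) by have := cabs_tri x c e; move: xc2; lra.
  apply: ler_pM; rewrite ?mulr_ge0 ?exprn_ge0 ?cabs_ge0 //.
    by apply: ler_pM; rewrite ?cabs_ge0.
  by apply: lerXn2r; rewrite ?nnegrE ?cabs_ge0 //; apply: fM; rewrite xc1.
move=> z zr; have [zr2|zr2] := leP (r / 2) (N (z - c)); first by apply: fM; rewrite zr2.
(* As [z] may be exceptional, the bound is taken at a nearby point that avoids [e1] and [e2], and
   passed to [z] by continuity. *)
apply/ler_addgt0Pr => e e0.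
have [d d0 Hd] := cf z zr _ e0.
have g0 : 0 < Num.min d (r / 2 - N (z - c)) by rewrite lt_min d0 subr_gt0.
have [d1 /andP[d10 d1d] H1] := avoid_point z e1 g0.
have [d2 /andP[d20 d2d] H2] := avoid_point z e2 d10.
have xz : N (z + rc (d2 / 2) - z) = d2 / 2.
  by rewrite addrC addKr cabs_rc ger0_norm // ltW // divr_gt0.
move: d1d; rewrite le_min => /andP[d1d d1r].
set x := z + rc (d2 / 2) in xz.
have := off x; have := Hd x; have := H1 x; have := H2 x; rewrite xz.
have -> : 0 < d2 / 2 < d2 by apply/andP; lra.
have -> : 0 < d2 / 2 < d1 by apply/andP; lra.
have -> : d2 / 2 < d by lra.
have -> : N (x - c) < r / 2 by have := cabs_tri x z c; rewrite xz; lra.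
move=> /(_ isT) x2 /(_ isT) x1 /(_ isT) fx /(_ isT x1 x2).
have := cabs_rev (f z) (f x); rewrite (cabsC (f z) (f x)); lra.
Qed.

Lemma max_principle1 f c (r M : R) e : 0 <= M ->
  ctsat f e ->
  (forall x, N (x - c) < r -> x != e -> exists m, isD f x m) ->
  (forall x, r / 2 <= N (x - c) < r -> N (f x) <= M) ->
  forall z, N (z - c) < r -> N (f z) <= M.
Proof.
move=> M0 cf fD; apply: (max_principle (e1 := e) (e2 := e)) => // [x xc|x xc xe _].
  have [->//|xe] := eqVneq x e.
  by have [m /isD_cts] := fD _ xc xe.
exact: fD.
Qed.

Lemma max_principle0 f c (r M : R) : 0 <= M ->
  (forall x, N (x - c) < r -> exists m, isD f x m) ->
  (forall x, r / 2 <= N (x - c) < r -> N (f x) <= M) ->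
  forall z, N (z - c) < r -> N (f z) <= M.
Proof.
move=> M0 fD fM z zc; apply: (max_principle (e1 := c) (e2 := c) M0 _ _ fM) => //.
  by move=> x /fD[m /isD_cts].
by move=> x /fD.
Qed.

End MaximumPrinciple.

(** * Local theory *)

Section LocalTheory.
Variable R : realType.
Local Notation C := (cplx R).
Local Notation N := (@cabs R).
Implicit Types (x y z w a b c : C) (f h : C -> C) (k n : nat).

Definition diff_on c (r : R) f := forall x, N (x - c) < r -> exists m, isD f x m.

Lemma diff_on_sub c c' (r r' : R) f : N (c' - c) + r' <= r ->
  diff_on c r f -> diff_on c' r' f.
Proof.
by move=> cr fD x xc; apply: fD; have := cabs_tri x c' c; lra.
Qed.

Lemma isD_subl f (a : C) z l : isD f z l -> isD (fun x => f x - a) z l.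
Proof. by move=> fz; rewrite -[l]subr0; apply: isDB => //; exact: isD_cst. Qed.

Lemma dslope_ctsat f c (r : R) y l x : diff_on c r f -> isD f y l ->
  N (x - c) < r -> ctsat (dslope f y l) x.
Proof.
move=> fD fy xc; have [->|xy] := eqVneq x y; first exact: isD_dslope.
have [m fx] := fD _ xc; have [m'] := dslope_isD_off l xy fx; exact: isD_cts.
Qed.

Lemma dslopeE f y l x : x != y -> dslope f y l x = (f x - f y) / (x - y).
Proof. by rewrite /dslope => /negbTE ->. Qed.

Lemma cabs_dslope f y l x (A d : R) : 0 < d -> d <= N (x - y) ->
  N (f x - f y) <= A -> N (dslope f y l x) <= A / d.
Proof.
move=> d0 dxy fA; have xy : x != y by rewrite -subr_eq0 -cabs_gt0; lra.
rewrite dslopeE // cabsf; apply: ler_pM; rewrite ?cabs_ge0 ?invr_ge0 ?cabs_ge0 //.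
by rewrite lef_pV2 ?posrE //; lra.
Qed.

(** * Difference quotients of bounded functions *)

Section Bounded.
Variables (f : C -> C) (c : C) (r M : R).
Hypotheses (fD : diff_on c r f) (fM : forall x, N (x - c) < r -> N (f x) <= M).

(** On the outer annulus [x] is at distance at least [r / 4] from [y] and the numerator is at most
    [2 * M]; the maximum principle with exceptional point [y] carries the quotient bound inwards. *)
Lemma dslope_bound y l : N (y - c) < r / 4 -> isD f y l ->
  forall x, N (x - c) < r -> N (dslope f y l x) <= 8 * M / r.
Proof.
move=> yc fy; have r0 : 0 < r by have := cabs_ge0 (y - c); move: yc; lra.
have fyM : N (f y) <= M by apply: fM; move: yc; lra.
have M0 : 0 <= M by apply: le_trans fyM; exact: cabs_ge0.
apply: (max_principle1 (e := y)); first by rewrite divr_ge0 ?mulr_ge0 // ltW.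
- exact: isD_dslope.
- by move=> x xc xy; have [m fx] := fD xc; exact: dslope_isD_off fx.
- move=> x /andP[xc1 xc2]; have -> : 8 * M / r = 2 * M / (r / 4).
    by field; rewrite gt_eqF.
  apply: cabs_dslope; first by rewrite divr_gt0.
    have -> : x - y = x - c - (y - c) by ring.
    by have := cabs_rev (x - c) (y - c); lra.
  by have := cabsB (f x) (f y); have := fM xc2; lra.
Qed.

Lemma lipschitz y x : N (y - c) < r / 4 -> N (x - c) < r ->
  N (f x - f y) <= 8 * M / r * N (x - y).
Proof.
move=> yc xc; have [l fy] : exists l, isD f y l.
  by apply: fD; have := cabs_ge0 (y - c); move: yc; lra.
rewrite (dslopeK f y l) cabsM ler_wpM2r ?cabs_ge0 //; exact: dslope_bound.
Qed.

Lemma derivative_bound y l : N (y - c) < r / 4 -> isD f y l -> N l <= 8 * M / r.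
Proof.
move=> yc fy; rewrite -(dslopexx f y l); apply: dslope_bound => //.
by have := cabs_ge0 (y - c); move: yc; lra.
Qed.

(** The difference quotient at [v] of the difference quotient at [y] is bounded by 2 (8 M / r) / (r
    / 4) on the annulus. It has the exceptional points [y] and [v], which is why the maximum
    principle allows two, and its value at [y] is the wanted second order term. *)
Lemma second_order y v l : N (y - c) < r / 4 -> N (v - c) < r / 4 -> isD f y l ->
  N (f v - f y - l * (v - y)) <= 64 * M / r ^+ 2 * N (v - y) ^+ 2.
Proof.
move=> yc vc fy; have r0 : 0 < r by have := cabs_ge0 (y - c); move: yc; lra.
have [->|vy] := eqVneq v y.
  by rewrite !subrr mulr0 subr0 cabs0 expr0n mulr0.
pose q := dslope f y l; have qb := dslope_bound yc fy.
have vr : N (v - c) < r by move: vc; lra.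
have yr : N (y - c) < r by move: yc; lra.
have [m qv] : exists m, isD q v m.
  by have [m fv] := fD vr; exact: dslope_isD_off fv.
have cq x : N (x - c) < r -> ctsat q x by exact: dslope_ctsat.
have K0 : 0 <= 8 * M / r by apply: le_trans (qb _ yr); exact: cabs_ge0.
have E : 64 * M / r ^+ 2 = 2 * (8 * M / r) / (r / 4) by field; rewrite gt_eqF.
have M0 : 0 <= 64 * M / r ^+ 2.
  rewrite E; apply: divr_ge0; first exact: mulr_ge0.
  by apply: divr_ge0 => //; exact: ltW.
have := @max_principle _ (dslope q v m) c r (64 * M / r ^+ 2) y v M0 _ _ _ y yr.
rewrite (dslopeE _ _ (_ : y != v)) 1?eq_sym // /q dslopexx => H.
have {}H : N ((l - q v) / (y - v)) <= 64 * M / r ^+ 2.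
  apply: H.
  - move=> x xc; have [->|xv] := eqVneq x v; first exact: isD_dslope.
    apply: (cts_near (f := fun t => (q t - q v) * (t - v)^-1)
      (_ : 0 < N (x - v))); first by rewrite cabs_gt0 subr_eq0.
      move=> t tx; rewrite dslopeE //; apply: contraTneq tx => ->.
      by rewrite cabsC ltxx.
    apply: ctsM; first by apply: ctsB; [exact: cq | exact: cts_cst].
    apply: ctsV; first by rewrite subr_eq0.
    by apply: ctsB; [exact: cts_id | exact: cts_cst].
  - move=> x xc xy xv; have [m1 fx] := fD xc.
    by have [m2 qx] := dslope_isD_off l xy fx; exact: dslope_isD_off qx.
  - move=> x /andP[xc1 xc2]; rewrite E.
    apply: cabs_dslope; first by rewrite divr_gt0.
      have -> : x - v = x - c - (v - c) by ring.
      by have := cabs_rev (x - c) (v - c); move: vc; lra.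
    by have := cabsB (q x) (q v); have := qb _ xc2; have := qb _ vr; rewrite -/q; lra.
rewrite (dslopeK f y l) -mulrBl -/q cabsM expr2 mulrA.
apply: ler_wpM2r; first exact: cabs_ge0.
move: H; rewrite cabsf ler_pdivrMr ?cabs_gt0 ?subr_eq0 1?eq_sym //.
by rewrite (cabsC l) (cabsC y).
Qed.

End Bounded.

(** The second order estimate at [y] involves the derivative [l] at [y]; using it from [y] to [w]
    and from [w] to [y] bounds [l - b] by a multiple of the distance from [y] to [w]. *)
Lemma strict_diff f w (r : R) b (e : R) : 0 < r -> diff_on w r f -> isD f w b ->
  0 < e -> exists2 d : R, 0 < d <= r & forall x y, N (x - w) < d -> N (y - w) < d ->
    N (f x - f y - b * (x - y)) <= e * N (x - y).
Proof.
move=> r0 fD fw e0.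
have [M M0 fM] : exists2 M, 0 < M & forall x, N (x - w) <= r / 2 -> N (f x) <= M.
  apply: bounded_on_ball => x xw; have [|m] := fD x; first lra.
  exact: isD_cts.
pose s := r / 2; have s0 : 0 < s by rewrite divr_gt0.
have fDs : diff_on w s f by apply: diff_on_sub fD; rewrite subrr cabs0 /s; lra.
have fMs x : N (x - w) < s -> N (f x) <= M by move=> /ltW; exact: fM.
have [K K0 so] : exists2 K : R, 0 < K & forall y v l, N (y - w) < s / 4 ->
    N (v - w) < s / 4 -> isD f y l ->
    N (f v - f y - l * (v - y)) <= K * N (v - y) ^+ 2.
  exists (64 * M / s ^+ 2); last exact: second_order fDs fMs.
  by apply: divr_gt0; [exact: mulr_gt0 | exact: exprn_gt0].
(* [s / 4] is the range of the second order estimate; the errors add up to [K] times one distance of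
   [x] and three of [y] to [w], whence [4 * K]. *)
exists (Num.min (s / 4) (e / (4 * K))).
  rewrite lt_min ge_min !divr_gt0 ?mulr_gt0 //=.
  by apply/orP; left; rewrite /s; lra.
move=> x y; rewrite !lt_min => /andP[xs xe] /andP[ys ye].
move: xe ye; rewrite !ltr_pdivlMr ?mulr_gt0 // => xe ye.
have ww : N (w - w) < s / 4 by rewrite subrr cabs0 divr_gt0.
have [l fy] : exists l, isD f y l by apply: fDs; move: ys s0; lra.
have h1 := so y x l ys xs fy.
have lb : N (l - b) <= 2 * K * N (y - w).
  have [yw|yw] := eqVneq y w.
    by rewrite yw in fy; rewrite (isD_unique fy fw) yw !subrr cabs0 mulr0.
  have h2 := so y w l ys ww fy; have h3 := so w y b ww ys fw.
  have y0 : 0 < N (y - w) by rewrite cabs_gt0 subr_eq0.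
  rewrite -(ler_pM2r y0) -cabsM.
  have -> : (l - b) * (y - w) = (f w - f y - l * (w - y)) + (f y - f w - b * (y - w)) by ring.
  apply: le_trans (cabsD _ _) _; move: h2; rewrite (cabsC w y); nra.
have -> : f x - f y - b * (x - y) = (f x - f y - l * (x - y)) + (l - b) * (x - y) by ring.
apply: le_trans (cabsD _ _) _; rewrite cabsM.
have xy : N (x - y) <= N (x - w) + N (y - w) by rewrite (cabsC y w); exact: cabs_tri.
have xy0 := cabs_ge0 (x - y).
have h4 : N (l - b) * N (x - y) <= 2 * K * N (y - w) * N (x - y) by rewrite ler_wpM2r.
have h5 : K * N (x - y) ^+ 2 <= K * (N (x - w) + N (y - w)) * N (x - y).
  by rewrite expr2 mulrA ler_wpM2r // ler_wpM2l // ltW.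
have h6 : (K * (N (x - w) + N (y - w)) + 2 * K * N (y - w)) * N (x - y) <= e * N (x - y).
  by apply: ler_wpM2r => //; lra.
lra.
Qed.

(* If [f] omitted [y] near [w], then [1 / (f - y)] would contradict the maximum
   principle. *)
Lemma local_inverse f w (r : R) b : 0 < r -> diff_on w r f -> isD f w b -> b != 0 ->
  exists2 d : R, 0 < d <= r &
    (forall x y, N (x - w) < d -> N (y - w) < d ->
       N b / 2 * N (x - y) <= N (f x - f y)) /\
    (forall (e : R) y, 0 < e <= d -> N (y - f w) < N b * e / 8 ->
       exists2 x, N (x - w) < e & f x = y).
Proof.
move=> r0 fD fw b0; have Nb : 0 < N b by rewrite cabs_gt0.
have e0 : 0 < N b / 2 by rewrite divr_gt0.
have [d /andP[d0 dr] Hd] := strict_diff r0 fD fw e0.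
have ex x y : N (x - w) < d -> N (y - w) < d -> N b / 2 * N (x - y) <= N (f x - f y).
  move=> xw yw; have := Hd x y xw yw.
  have := cabs_rev (b * (x - y)) (f x - f y); rewrite (cabsC (b * _)) cabsM; lra.
exists d; first by rewrite d0.
split=> // e y /andP[e00 ed] yw; apply: contrapT => nx.
have fy x : N (x - w) < e -> f x - y != 0.
  by move=> xe; rewrite subr_eq0; apply/eqP => fxy; apply: nx; exists x.
(* For [e / 2 <= N (x - w)] the value [f x] is at least [N b * e / 4] away from [f w], hence
   [N b * e / 8] away from [y], whereas [f w] is closer to [y] than that. *)
have k0 : 0 < N b * e / 8 by rewrite divr_gt0 // mulr_gt0.
have := @max_principle0 _ (fun x => (f x - y)^-1) w e (N b * e / 8)^-1 _ _ _ w.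
rewrite subrr cabs0 cabsV => H.
have {H} : (N (f w - y))^-1 <= (N b * e / 8)^-1.
  apply: H => //; first by rewrite invr_ge0 ltW.
    move=> x xe; have [|m fx] := fD x; first lra.
    by eexists; apply: isDV; [exact: fy | exact: isD_subl fx].
  move=> x /andP[xe1 xe2]; rewrite cabsV lef_pV2 ?posrE ?cabs_gt0 ?fy //.
  have ww : N (w - w) < d by rewrite subrr cabs0.
  have xd : N (x - w) < d by lra.
  have := ex _ _ xd ww; have := cabs_tri (f x) y (f w).
  have : N b / 2 * (e / 2) <= N b / 2 * N (x - w) by rewrite ler_pM2l.
  lra.
have fwy : 0 < N (f w - y) by rewrite cabs_gt0 fy // subrr cabs0.
by rewrite lef_pV2 ?posrE // leNgt cabsC yw.
Qed.

(* The maximum principle for [(f - a) / (x - c) ^ n] as n grows. *)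
Lemma identity_ball f c a (r d : R) : 0 < d -> diff_on c r f ->
  (exists M, forall x, N (x - c) < r -> N (f x) <= M) ->
  (forall x, N (x - c) < d -> f x = a) ->
  forall x, N (x - c) < r / 2 -> f x = a.
Proof.
move=> d0 fD [M fM] fa x xc; apply/eqP; rewrite -subr_eq0 -cabs_eq0.
apply: contraT => nz.
have r0 : 0 < r by have := cabs_ge0 (x - c); move: xc; lra.
have cc : N (c - c) < r by rewrite subrr cabs0.
have M0 : 0 <= M by apply: le_trans (fM _ cc); exact: cabs_ge0.
have r20 : 0 < r / 2 by rewrite divr_gt0.
have k0 : 0 < N (f x - a) by rewrite lt_neqAle eq_sym nz cabs_ge0.
suff : r / 2 <= N (x - c) by move: xc; lra.
apply: (@le_of_powers _ _ (M + N a) _ _ k0 (cabs_ge0 _) (ltW r20)) => n.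
have [xc0|xc0] := eqVneq x c; first by move: nz; rewrite xc0 fa ?subrr ?cabs0 ?eqxx.
have xr : N (x - c) < r by move: xc; lra.
have p0 : 0 < N (x - c) ^+ n by rewrite exprn_gt0 // cabs_gt0 subr_eq0.
have q0 : 0 < (r / 2) ^+ n by rewrite exprn_gt0.
suff : N ((f x - a) / (x - c) ^+ n) <= (M + N a) / (r / 2) ^+ n.
  by rewrite cabsf cabsX ler_pdivrMr // mulrAC ler_pdivlMr.
apply: (max_principle0 (f := fun t => (f t - a) / (t - c) ^+ n) _ _ _ xr).
- by apply: divr_ge0; [exact: addr_ge0 M0 (cabs_ge0 _) | exact: ltW].
- move=> t tc; have [->|tn] := eqVneq t c.
    exists 0; apply: (isD_near (f := fun=> 0) d0); last exact: isD_cst.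
    by move=> u /fa ->; rewrite subrr mul0r.
  have [m ft] := fD _ tc.
  have [m' hm'] := isDX n (isD_subl c (isD_id t)).
  eexists; apply: isDM; first exact: isD_subl ft.
  by apply: isDV hm'; rewrite expf_neq0 // subr_eq0.
- move=> t /andP[t1 t2]; rewrite cabsf cabsX; apply: ler_pM.
  + exact: cabs_ge0.
  + by rewrite invr_ge0 exprn_ge0 ?cabs_ge0.
  + by apply: le_trans (cabsB _ _) _; rewrite lerD2r fM.
  + rewrite lef_pV2 ?posrE // ?exprn_gt0 //; last by apply: lt_le_trans t1.
    by apply: lerXn2r => //; rewrite ?nnegrE ?cabs_ge0 // ltW.
Qed.

Lemma mul_div_sqr (t u : R) : 0 < t -> t * (u / t ^+ 2) = u / t.
Proof. by move=> t0; field; rewrite gt_eqF. Qed.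

(** Cutting the segment from [c] to [x] into n + 1 equal steps leaves a second order error per step,
    of total size [K * d ^+ 2 / n.+1%:R]. *)
Lemma zero_derivative_ball f c (r : R) : diff_on c r f ->
  (exists M, forall x, N (x - c) < r -> N (f x) <= M) ->
  (forall x, N (x - c) < r / 4 -> isD f x 0) ->
  forall x, N (x - c) < r / 4 -> f x = f c.
Proof.
move=> fD [M fM] f0 x xc.
have r0 : 0 < r by have := cabs_ge0 (x - c); move: xc; lra.
have so := second_order fD fM.
set K := 64 * M / r ^+ 2 in so; set d := N (x - c).
have d0 : 0 <= d by exact: cabs_ge0.
have step n : N (f x - f c) <= K * d ^+ 2 / n.+1%:R.
  pose p j := c + rc (j%:R / n.+1%:R) * (x - c).
  have n0 : 0 < n.+1%:R :> R by rewrite ltr0n.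
  have pc j : (j <= n.+1)%N -> N (p j - c) < r / 4.
    move=> jn; rewrite /p addrC addKr cabsM cabs_rc ger0_norm ?divr_ge0 //.
    apply: le_lt_trans xc; rewrite -/d; apply: ler_piMl => //.
    by rewrite ler_pdivrMr // mul1r ler_nat.
  have H j : (j <= n.+1)%N -> N (f (p j) - f c) <= j%:R * (K * d ^+ 2 / n.+1%:R ^+ 2).
    elim: j => [|j IH] jn; first by rewrite /p !mul0r addr0 subrr cabs0.
    have := so (p j) (p j.+1) 0 (pc _ (ltnW jn)) (pc _ jn) (f0 _ (pc _ (ltnW jn))).
    have -> : p j.+1 - p j = rc (n.+1%:R^-1) * (x - c).
      rewrite /p opprD addrACA subrr add0r -mulrBl -rcB -mulrBl -natr1.
      by rewrite (addrC j%:R 1) addrK mul1r.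
    rewrite mul0r subr0 cabsM cabs_rc ger0_norm ?invr_ge0 ?(ltW n0) // -/d => h.
    have := cabs_tri (f (p j.+1)) (f (p j)) (f c); have := IH (ltnW jn).
    have E : K * (n.+1%:R^-1 * d) ^+ 2 = K * d ^+ 2 / n.+1%:R ^+ 2.
      by rewrite exprMn exprVn; ring.
    move: h; rewrite E; set t := _ / _; rewrite -[j.+1%:R]natr1 mulrDl mul1r; lra.
  have := H n.+1 (leqnn _); rewrite /p divff ?gt_eqF // rc1 mul1r (addrC c) subrK.
  by rewrite mul_div_sqr.
apply/eqP; rewrite -subr_eq0 -cabs_eq0 eq_le cabs_ge0 andbT.
apply/ler_addgt0Pr => e e0; rewrite add0r.
set n := Num.bound `|K * d ^+ 2 / e|.
apply: le_trans (step n) _; rewrite ler_pdivrMr ?ltr0n //.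
have := archi_boundP (normr_ge0 (K * d ^+ 2 / e)); rewrite -/n => h.
have : K * d ^+ 2 / e < n%:R by apply: le_lt_trans h; exact: ler_norm.
by rewrite ltr_pdivrMr // -natr1; lra.
Qed.

(** * Entire functions: identity theorem and linear growth *)

Section EntireFunctions.
Variable f : C -> C.
Hypothesis fE : forall x, exists m, isD f x m.

Lemma entire_diff_on c (r : R) : diff_on c r f.
Proof. by move=> x _; exact: fE. Qed.

Lemma entire_bounded c (r : R) : exists M, forall x, N (x - c) < r -> N (f x) <= M.
Proof.
have [|M _ HM] := @bounded_on_ball _ f c r.
  by move=> x _; have [m /isD_cts] := fE x.
by exists M => x /ltW; exact: HM.
Qed.

Lemma identity_entire c a (d : R) : 0 < d -> (forall x, N (x - c) < d -> f x = a) ->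
  forall x, f x = a.
Proof.
move=> d0 fa x.
(* [identity_ball] reaches only half of its radius; the added 1 makes the inequality strict. *)
apply: (@identity_ball f c a (2 * (N (x - c) + 1)) d) => //.
- exact: entire_bounded.
- by lra.
Qed.

Lemma zero_derivative_entire c (d : R) : 0 < d ->
  (forall x, N (x - c) < d -> isD f x 0) -> forall x, f x = f c.
Proof.
move=> d0 f0; apply: (@identity_entire c _ d) => // x xd.
apply: (@zero_derivative_ball f c (4 * d)).
- exact: entire_diff_on.
- exact: entire_bounded.
- by move=> y yd; apply: f0; lra.
- by lra.
Qed.

(* The second difference quotient of [f] tends to 0 at infinity. *)
Lemma linear_growth c (K : R) :
  (forall (r : R) x, N (x - c) < r -> N (f x - f c) <= K * r) ->
  exists b, forall x, f x = f c + b * (x - c).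
Proof.
move=> fK; have [l fc] := fE c; pose q := dslope f c l.
have K0 : 0 <= K.
  have := fK 1 c; rewrite !subrr cabs0 mulr1; apply; exact: ltr01.
have qK x : N (q x) <= 2 * K.
  have x0 := cabs_ge0 (x - c).
  have xr : N (x - c) < N (x - c) + 1 by lra.
  apply: (max_principle1 (e := c) (c := c) (r := N (x - c) + 1)) xr => //.
  - by rewrite mulr_ge0.
  - exact: isD_dslope.
  - by move=> y _ yc; have [m fy] := fE y; exact: dslope_isD_off fy.
  - move=> y /andP[y1 y2]; set r := N (x - c) + 1 in y1 y2.
    have r0 : 0 < r by rewrite /r; lra.
    have -> : 2 * K = K * r / (r / 2) by field; rewrite gt_eqF.
    by apply: cabs_dslope => //; [rewrite divr_gt0 | exact: fK].
pose v := c + 1; have vc : v != c.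
  by rewrite -subr_eq0 /v addrC addKr oner_eq0.
have vc1 : N (v - c) = 1 by rewrite /v addrC addKr cabs1.
have [m qv] : exists m, isD q v m by have [m fv] := fE v; exact: dslope_isD_off fv.
exists (q v) => x; suff -> : q v = q x by rewrite -dslopeK; ring.
apply/eqP; rewrite eq_sym -subr_eq0 -cabs_eq0 eq_le cabs_ge0 andbT.
apply/ler_addgt0Pr => e e0; rewrite add0r.
have [xv|xv] := eqVneq x v; first by rewrite xv subrr cabs0 ltW.
have p0 : 0 < N (x - v) by rewrite cabs_gt0 subr_eq0.
(* The first two terms put [x] in the disk and keep [v], at distance 1 from [c], at least [r / 4]
   away from the outer annulus. The last one brings the final bound [16 * K / r * N (x - v)] below
   [e]. *)
pose r := 4 + N (x - c) + 16 * K * N (x - v) / e.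
have r4 : 4 + N (x - c) <= r.
  by rewrite lerDl divr_ge0 ?mulr_ge0 ?cabs_ge0 // ltW.
have x0 := cabs_ge0 (x - c).
have r0 : 0 < r by lra.
have xr : N (x - c) < r by lra.
have : N (dslope q v m x) <= 16 * K / r.
  apply: (max_principle (e1 := c) (e2 := v)) xr.
  - by rewrite divr_ge0 ?mulr_ge0 // ltW.
  - move=> y yr; have [->|yv] := eqVneq y v; first exact: isD_dslope.
    apply: (cts_near (f := fun t => (q t - q v) * (t - v)^-1)
      (_ : 0 < N (y - v))); first by rewrite cabs_gt0 subr_eq0.
      move=> t tx; rewrite dslopeE //; apply: contraTneq tx => ->.
      by rewrite cabsC ltxx.
    apply: ctsM; first apply: ctsB; last (apply: ctsV; first by rewrite subr_eq0).
    + by apply: (dslope_ctsat (c := c) (r := r)) => //; exact: entire_diff_on.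
    + exact: cts_cst.
    + by apply: ctsB; [exact: cts_id | exact: cts_cst].
  - move=> y yr yc yv; have [m1 fy] := fE y.
    by have [m2 qy] := dslope_isD_off l yc fy; exact: dslope_isD_off qy.
  - move=> y /andP[y1 y2].
    have -> : 16 * K / r = 4 * K / (r / 4) by field; rewrite gt_eqF.
    apply: cabs_dslope; first by rewrite divr_gt0.
      by have := cabs_tri y v c; rewrite vc1; lra.
    by have := cabsB (q y) (q v); have := qK y; have := qK v; lra.
rewrite dslopeE // cabsf ler_pdivrMr // => h; apply: le_trans h _.
rewrite mulrAC ler_pdivrMr //.
have : 16 * K * N (x - v) / e <= r by rewrite /r; lra.
by rewrite ler_pdivrMr //; lra.
Qed.

End EntireFunctions.
End LocalTheory.

(** * Lifting along an entire function *)

Section Lifting.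
Variable R : realType.
Local Notation C := (cplx R).
Local Notation N := (@cabs R).
Implicit Types (x y z w a b : C) (phi psi : C -> C) (k n : nat) (V : set C).

Definition disk c (r : R) : set C := [set x | N (x - c) < r].

Definition convex V := forall x y (t : R), V x -> V y -> 0 <= t <= 1 ->
  V (x + rc t * (y - x)).

Lemma disk_convex c (r : R) : convex (disk c r).
Proof.
move=> x y t /= xc yc /andP[t0 t1]; rewrite /disk /=.
have -> : x + rc t * (y - x) - c = rc (1 - t) * (x - c) + rc t * (y - c).
  by rewrite rcB rc1; ring.
apply: le_lt_trans (cabsD _ _) _; rewrite !cabsM !cabs_rc !ger0_norm //; last lra.
move: xc yc; rewrite /disk /=; set u := N _; set v := N _ => ur vr.
have [t'|t'] := eqVneq t 0; first by rewrite t'; lra.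
by have : 0 < t; [rewrite lt_neqAle eq_sym t' | nra].
Qed.

Lemma convexI V W : convex V -> convex W -> convex (V `&` W).
Proof. by move=> cV cW x y t [? ?] [? ?] ?; split; [exact: cV | exact: cW]. Qed.

(** Connectedness of the unit interval for a property whose truth is locally constant, by the
    supremum of the initial stretches on which it holds. *)
Lemma segment_induction (P : R -> Prop) : P 0 ->
  (forall t, 0 <= t <= 1 -> exists2 d : R, 0 < d &
     forall s, 0 <= s <= 1 -> `|s - t| < d -> (P s <-> P t)) -> P 1.
Proof.
move=> P0 loc.
pose S := [set t : R | 0 <= t <= 1 /\ forall s, 0 <= s <= t -> P s].
have S0 : S 0.
  by split=> [|s]; [rewrite lexx ler01 | rewrite -eq_le => /eqP <-].
have ubS : ubound S 1 by move=> t [/andP[]].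
have hS : has_sup S by split; [exists 0 | exists 1].
set m := sup S.
have m0 : 0 <= m by apply: ub_le_sup S0; exact: hS.2.
have m1 : m <= 1 by apply: ge_sup => //; exists 0.
have m01 : 0 <= m <= 1 by rewrite m0.
have [d d0 Hd] := loc m m01.
have below s : 0 <= s -> s < m -> P s.
  move=> s0 sm; have ms : 0 < m - s by rewrite subr_gt0.
  have [t [_ Ht]] := sup_adherent ms hS.
  by rewrite -/m => st; apply: Ht; rewrite s0 /=; move: st; lra.
have Pm : P m.
  have [mz|mz] := eqVneq m 0; first by rewrite mz.
  have mp : 0 < m by rewrite lt_neqAle eq_sym mz.
  pose s := Num.max 0 (m - d / 2).
  have sm : s < m by rewrite /s gt_max mp; lra.
  have s0 : 0 <= s by rewrite /s le_max lexx.
  have sd : m - d / 2 <= s by rewrite /s le_max lexx orbT.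
  have s01 : 0 <= s <= 1 by rewrite s0; lra.
  apply/(Hd s s01); last exact: below.
  by rewrite distrC gtr0_norm; lra.
have [m1'|m1'] := eqVneq m 1; first by rewrite -m1'.
have mlt : m < 1 by rewrite lt_neqAle m1'.
pose u := Num.min 1 (m + d / 2).
have um : m < u by rewrite /u lt_min mlt; lra.
have u1 : u <= 1 by rewrite /u ge_min lexx.
have ud : u <= m + d / 2 by rewrite /u ge_min lexx orbT.
suff : S u by move=> /(ub_le_sup hS.2); rewrite -/m leNgt um.
split=> [|s /andP[s0 su]]; first by rewrite u1 andbT; lra.
have [sm|ms] := ltP s m; first exact: below.
have s01 : 0 <= s <= 1 by rewrite s0; lra.
by apply/(Hd s s01) => //; rewrite ger0_norm; lra.
Qed.

(** Dividing the Caratheodory slope of [A] by that of [F] along [phi] gives a slope for [phi].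
    Continuity of [phi] suffices, so lifts need only be built as continuous functions. *)
Lemma implicit_isD F A phi x a b (d : R) : 0 < d -> isD F (phi x) b -> b != 0 ->
  ctsat phi x -> (forall y, N (y - x) < d -> F (phi y) = A y) -> isD A x a ->
  isD phi x (a / b).
Proof.
move=> d0 Fb b0 cphi Fphi [q [cq qa Hq]].
have cp := isD_dslope Fb; set p := dslope F (phi x) b in cp.
have pb : p (phi x) = b by exact: dslopexx.
have cpp : ctsat (fun y => p (phi y)) x by exact: cts_comp.
have pn0 : p (phi x) != 0 by rewrite pb.
have Nb : 0 < N b by rewrite cabs_gt0.
have [d1 d10 Hd1] := cpp _ Nb.
have m0 : 0 < Num.min d d1 by rewrite lt_min d0.
have cq' : ctsat (fun y => q y / p (phi y)) x by apply: ctsM => //; exact: ctsV.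
have H y : N (y - x) < Num.min d d1 -> phi y - phi x = q y / p (phi y) * (y - x).
  rewrite lt_min => /andP[yd yd1].
  have pn : p (phi y) != 0.
    by apply: contraTneq (Hd1 _ yd1) => ->; rewrite pb sub0r cabsN ltxx.
  have := dslopeK F (phi x) b (phi y).
  rewrite (Fphi _ yd) (Fphi x) ?subrr ?cabs0 // Hq -/p => E.
  by apply: (mulfI pn); rewrite -E; field.
apply: (isD_near (f := fun y => phi x + q y / p (phi y) * (y - x)) m0).
  by move=> y /H <-; ring.
exists (fun y => q y / p (phi y)); split=> //; first by rewrite qa pb.
by move=> y; rewrite subrr mulr0 addr0; ring.
Qed.

Section Lifts.
Variables (F A : C -> C) (c : C) (r : R).
Hypothesis FE : forall x, exists m, isD F x m.
Hypothesis Acts : forall x, N (x - c) < r -> ctsat A x.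
Hypothesis reg : forall w x, N (x - c) < r -> F w = A x -> ~ isD F w 0.

(** Two cases are served at once: [A] is the identity for inverse branches of [F], and the radicand
    for square roots, where [F] is squaring. *)
Definition is_lift V phi := forall x, V x -> ctsat phi x /\ F (phi x) = A x.

Lemma lift_sub V W phi : W `<=` V -> is_lift V phi -> is_lift W phi.
Proof. by move=> WV H x /WV; exact: H. Qed.

Lemma regular_inverse w x : N (x - c) < r -> F w = A x ->
  exists2 b, b != 0 & exists2 d : R, 0 < d &
    (forall x y, N (x - w) < d -> N (y - w) < d ->
       N b / 2 * N (x - y) <= N (F x - F y)) /\
    (forall (e : R) y, 0 < e <= d -> N (y - F w) < N b * e / 8 ->
       exists2 x, N (x - w) < e & F x = y).
Proof.
move=> xc Fw; have [b Fb] := FE w; exists b.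
  by apply/eqP => b0; apply: (reg xc Fw); rewrite -b0.
have [|d /andP[d0 _] Hd] := local_inverse ltr01 (@entire_diff_on _ F FE w 1) Fb.
  by apply/eqP => b0; apply: (reg xc Fw); rewrite -b0.
by exists d.
Qed.

(** Along the segment from [p] to [x], coincidence is locally constant: where the lifts agree, [F]
    is injective nearby; where they differ, continuity keeps them apart. *)
Lemma lift_unique V phi psi p : convex V -> V `<=` disk c r -> is_lift V phi ->
  is_lift V psi -> V p -> phi p = psi p -> forall x, V x -> phi x = psi x.
Proof.
move=> cV Vc lphi lpsi Vp e x Vx.
pose g (t : R) : C := p + rc t * (x - p).
have := @segment_induction (fun t => phi (g t) = psi (g t)).
rewrite /g rc0 rc1 mul0r mul1r addr0 (addrC p) subrK; apply=> // t t01.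
have Vt s : 0 <= s <= 1 -> V (g s) by move=> s01; exact: cV.
have gst s : N (g s - g t) = `|s - t| * N (x - p).
  have -> : g s - g t = rc (s - t) * (x - p) by rewrite /g rcB; ring.
  by rewrite cabsM cabs_rc.
have close (d : R) : 0 < d -> exists2 d' : R, 0 < d' &
    forall s, `|s - t| < d' -> N (g s - g t) < d.
  move=> d0; have xp : 0 < N (x - p) + 1 by have := cabs_ge0 (x - p); lra.
  exists (d / (N (x - p) + 1)); first by rewrite divr_gt0.
  move=> s; rewrite ltr_pdivlMr // gst.
  by have := normr_ge0 (s - t); have := cabs_ge0 (x - p); nra.
have [cphi Fphi] := lphi _ (Vt t t01); have [cpsi Fpsi] := lpsi _ (Vt t t01).
have [eq|ne] := eqVneq (phi (g t)) (psi (g t)).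
  have [b b0 [d d0 [Hd _]]] := regular_inverse (Vc _ (Vt t t01)) Fphi.
  have [d1 d10 H1] := cphi _ d0; have [d2 d20 H2] := cpsi _ d0.
  have m0 : 0 < Num.min d1 d2 by rewrite lt_min d10.
  have [d' d'0 H'] := close _ m0; exists d' => // s s01 /H'.
  rewrite lt_min => /andP[/H1 h1 /H2 h2]; split=> // _.
  have [_ Fs] := lphi _ (Vt s s01); have [_ Fs'] := lpsi _ (Vt s s01).
  rewrite -eq in h2; have := Hd _ _ h1 h2; rewrite -/(g s) Fs Fs' subrr cabs0 => h3.
  apply/eqP; rewrite -subr_eq0 -cabs_eq0 eq_le cabs_ge0 andbT.
  by rewrite -(pmulr_rle0 _ (_ : 0 < N b / 2)) // divr_gt0 // cabs_gt0.
have e0 : 0 < N (phi (g t) - psi (g t)) / 2 by rewrite divr_gt0 // cabs_gt0 subr_eq0.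
have [d1 d10 H1] := cphi _ e0; have [d2 d20 H2] := cpsi _ e0.
have m0 : 0 < Num.min d1 d2 by rewrite lt_min d10.
have [d' d'0 H'] := close _ m0; exists d' => // s s01 /H'.
rewrite lt_min => /andP[/H1 h1 /H2 h2]; split=> es; exfalso; last first.
  by rewrite -/(g t) es eqxx in ne.
rewrite -/(g s) in es; rewrite es in h1.
have := cabs_tri (phi (g t)) (psi (g s)) (psi (g t)).
by rewrite (cabsC (phi (g t)) (psi (g s))); move: h1 h2; lra.
Qed.

(** Beyond being a lift, [psi] catches every preimage close to [w]; this allows another lift to be
    recognised as [psi] from one value. *)
Lemma local_section x0 w : N (x0 - c) < r -> F w = A x0 ->
  exists2 e : R, 0 < e & exists2 eta : R, 0 < eta & exists psi,
    [/\ disk x0 e `<=` disk c r, is_lift (disk x0 e) psi &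
      forall x u, disk x0 e x -> N (u - w) < eta -> F u = A x -> u = psi x].
Proof.
move=> xc Fw; have [b b0 [d d0 [inj surj]]] := regular_inverse xc Fw.
have b0' : 0 < N b by rewrite cabs_gt0.
have k0 : 0 < N b * d / 8 by rewrite divr_gt0 // mulr_gt0.
have [e1 e10 He1] := Acts xc k0.
pose e := Num.min e1 (r - N (x0 - c)).
have e0 : 0 < e by rewrite lt_min e10 subr_gt0.
have sub : disk x0 e `<=` disk c r.
  move=> x; rewrite /disk /= lt_min => /andP[_ h].
  by have := cabs_tri x x0 c; lra.
have H x : exists u, disk x0 e x -> N (u - w) < d /\ F u = A x.
  case: (pselect (disk x0 e x)) => [xe|nx]; last by exists 0.
  have [||u uw Fu] := surj d (A x); first by rewrite d0 lexx.
    by rewrite Fw; apply: He1; move: xe; rewrite /disk /= lt_min => /andP[].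
  by exists u.
have [psi Hpsi] := choice H.
exists e => //; exists d => //; exists psi; split=> //.
  move=> x xe; have [h1 h2] := Hpsi _ xe; split=> // t t0.
  have k1 : 0 < N b / 2 * t by rewrite !mulr_gt0 // invr_gt0.
  have [d1 d10 Hd1] := Acts (sub _ xe) k1.
  exists (Num.min d1 (e - N (x - x0))); first by rewrite lt_min d10 subr_gt0.
  move=> y; rewrite lt_min => /andP[/Hd1 yd ye].
  have {}ye : disk x0 e y by rewrite /disk /=; have := cabs_tri y x x0; lra.
  have [h3 h4] := Hpsi _ ye; have := inj _ _ h3 h1; rewrite h2 h4 => h5.
  by rewrite -(ltr_pM2l (_ : 0 < N b / 2)) ?divr_gt0 //; exact: le_lt_trans h5 yd.
move=> x u xe uw Fu; have [h1 h2] := Hpsi _ xe.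
have := inj _ _ uw h1; rewrite Fu h2 subrr cabs0 => h3.
apply/eqP; rewrite -subr_eq0 -cabs_eq0 eq_le cabs_ge0 andbT.
by rewrite -(pmulr_rle0 _ (_ : 0 < N b / 2)) // divr_gt0.
Qed.

Lemma glue_lifts (I : Type) (V : I -> set C) (phi : I -> C -> C) :
  (forall i x, V i x -> exists2 d : R, 0 < d & disk x d `<=` V i) ->
  (forall i, is_lift (V i) (phi i)) ->
  (forall i j x, V i x -> V j x -> phi i x = phi j x) ->
  exists Phi, is_lift (\bigcup_i V i) Phi /\ forall i x, V i x -> Phi x = phi i x.
Proof.
move=> oV lV agree.
have H x : exists u, forall i, V i x -> u = phi i x.
  case: (pselect (exists i, V i x)) => [[i Vi]|nx].
    by exists (phi i x) => j Vj; exact: agree.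
  by exists 0 => i Vi; exfalso; apply: nx; exists i.
have [Phi HPhi] := choice H; exists Phi; split=> [x [i _ Vi]|i x]; last exact: HPhi.
have [cx Fx] := lV i x Vi; rewrite (HPhi _ _ Vi); split=> //.
have [d d0 Hd] := oV _ _ Vi.
by apply: cts_near d0 _ cx => y /Hd /HPhi ->.
Qed.

Definition asymptotic_curve (gamma : R -> C) a :=
  [/\ forall s, 0 <= s -> forall e : R, 0 < e -> exists2 d : R, 0 < d &
        forall t, 0 <= t -> `|t - s| < d -> N (gamma t - gamma s) < e,
      forall M : R, exists s0, forall s, s0 <= s -> M < N (gamma s) &
      forall e : R, 0 < e -> exists s0, forall s, s0 <= s -> N (F (gamma s) - a) < e].

Hypothesis noasym : forall x gamma, N (x - c) < r -> ~ asymptotic_curve gamma (A x).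

(* Following a lift along a radius of its disk, either the lift tends to
   infinity and the end point of the radius is an asymptotic value, or it
   accumulates at a regular point, near which [F] can be inverted. *)
Lemma boundary_section (rho : R) phi z : 0 < rho -> rho < r -> is_lift (disk c rho) phi ->
  N (z - c) = rho -> exists2 e : R, 0 < e & exists psi,
    [/\ disk z e `<=` disk c r, is_lift (disk z e) psi &
      forall x, disk c rho x -> disk z e x -> phi x = psi x].
Proof.
move=> rho0 rhor lphi zc.
have zr : N (z - c) < r by rewrite zc.
(* The open radius, reparametrised by the half line because asymptotic curves are. *)
pose g (s : R) : C := c + rc (s / (1 + s)) * (z - c).
have gc s : 0 <= s -> disk c rho (g s).
  move=> s0; have s1 : 0 < 1 + s by lra.
  rewrite /disk /= /g addrC addKr cabsM cabs_rc ger0_norm; last by rewrite divr_ge0 // ltW.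
  by rewrite zc mulrAC ltr_pdivrMr //; nra.
have gz s : 0 <= s -> N (g s - z) = rho / (1 + s).
  move=> s0; have s1 : 0 < 1 + s by lra.
  have -> : g s - z = - (rc ((1 + s)^-1) * (z - c)).
    rewrite /g; have -> : s / (1 + s) = 1 - (1 + s)^-1 by field; rewrite gt_eqF.
    by rewrite rcB rc1; ring.
  by rewrite cabsN cabsM cabs_rc zc ger0_norm ?invr_ge0 ?(ltW s1) // mulrC.
have gz0 (e : R) : 0 < e -> exists n, forall s, n%:R <= s -> N (g s - z) < e.
  move=> e0; exists (Num.bound `|rho / e|) => s ns.
  have s0 : 0 <= s by apply: le_trans ns; rewrite ler0n.
  have := archi_boundP (normr_ge0 (rho / e)); have := ler_norm (rho / e).
  move=> h1 h2; have : rho / e < 1 + s by lra.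
  by rewrite gz // ltr_pdivrMr // => h3; rewrite ltr_pdivrMr; [rewrite mulrC | lra].
have : ~ asymptotic_curve (phi \o g) (A z) by exact: noasym.
have cg : forall s, 0 <= s -> forall e : R, 0 < e -> exists2 d : R, 0 < d &
        forall t, 0 <= t -> `|t - s| < d -> N (phi (g t) - phi (g s)) < e.
  move=> s s0 e e0; have [cs _] := lphi _ (gc _ s0); have [d d0 Hd] := cs _ e0.
  exists (d / rho); first by rewrite divr_gt0.
  move=> t t0; rewrite ltr_pdivlMr // => td; apply: Hd; apply: le_lt_trans td.
  have s1 : 0 < 1 + s by lra.
  have t1 : 0 < 1 + t by lra.
  have -> : g t - g s = rc (t / (1 + t) - s / (1 + s)) * (z - c) by rewrite /g rcB; ring.
  rewrite cabsM cabs_rc zc ler_pM2r //.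
  have -> : t / (1 + t) - s / (1 + s) = (t - s) / ((1 + t) * (1 + s)).
    by field; rewrite !gt_eqF.
  rewrite normrM [X in _ * X]ger0_norm; last by rewrite invr_ge0 mulr_ge0 // ltW.
  rewrite -[leRHS]mulr1; apply: ler_wpM2l => //.
  by rewrite invf_le1 ?mulr_gt0 //; nra.
have cF : forall e : R, 0 < e -> exists s0, forall s, s0 <= s -> N (F (phi (g s)) - A z) < e.
  move=> e /(Acts zr)[d d0 Hd]; have [n Hn] := gz0 _ d0.
  exists n%:R => s ns; have s0 : 0 <= s by apply: le_trans ns; rewrite ler0n.
  by have [_ ->] := lphi _ (gc _ s0); apply: Hd; exact: Hn.
move=> nas.
have [M HM] : exists M : R, forall n, exists2 s : R, n%:R <= s & N (phi (g s)) <= M.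
  apply: contrapT => nM; apply: nas; split=> // M.
  apply: contrapT => nM'; apply: nM; exists M => n; apply: contrapT => ns; apply: nM'.
  by exists n%:R => s sn; rewrite ltNge; apply/negP => h; apply: ns; exists s.
have HM' n : exists s : R, n%:R <= s /\ N (phi (g s)) <= M.
  by have [s] := HM n; exists s.
have [s Hs] := choice HM'.
have s0 n : 0 <= s n by have [h _] := Hs n; apply: le_trans h; rewrite ler0n.
have sn n m : (n <= m)%N -> n%:R <= s m.
  by move=> nm; have [h _] := Hs m; apply: le_trans h; rewrite ler_nat.
have [w Hw] := @bolzano_weierstrass _ (fun n => phi (g (s n))) M (fun n => (Hs n).2).
have Fw : F w = A z.
  apply/eqP; rewrite -subr_eq0 -cabs_eq0 eq_le cabs_ge0 andbT.
  apply/ler_addgt0Pr => e e0; rewrite add0r.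
  have e20 : 0 < e / 2 by rewrite divr_gt0.
  have [m /isD_cts/(_ _ e20)[d d0 Hd]] := FE w.
  have [d' d'0 Hd'] := Acts zr e20.
  have [n Hn] := gz0 _ d'0; have [k nk kw] := Hw _ d0 n.
  have := Hd _ kw; have := Hd' _ (Hn _ (sn _ _ nk)).
  have [_ ->] := lphi _ (gc _ (s0 k)); set u := A (g _) => h1 h2.
  by have := cabs_tri (F w) u (A z); rewrite (cabsC (F w) u); lra.
have [e e0 [eta eta0 [psi [sub lpsi Hpsi]]]] := local_section zr Fw.
exists e => //; exists psi; split=> // x xc xz.
have [n Hn] := gz0 _ e0; have [k nk kw] := Hw _ eta0 n.
have gk : disk z e (g (s k)) by apply: Hn; exact: sn.
have gk' := gc _ (s0 k).
(* At [g (s k)] the lift is within [eta] of [w], so it agrees with [psi] there, and uniqueness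
   spreads this over the convex intersection. *)
apply: (@lift_unique (disk c rho `&` disk z e) phi psi (g (s k))) => //.
- by apply: convexI; exact: disk_convex.
- by move=> y [_ /sub].
- by apply: lift_sub lphi => y [].
- by apply: lift_sub lpsi => y [].
- by apply: Hpsi => //; have [] := lphi _ gk'.
Qed.

(** The point dividing the chord from [z] to [z'] in the ratio [e : e'] lies in both disks, and
    strict convexity of the circle puts it inside. There both boundary sections agree with the given
    lift, hence with each other. *)
Lemma disks_meet_inside (rho e e' : R) z z' x : N (z - c) = rho -> N (z' - c) = rho ->
  z != z' -> disk z e x -> disk z' e' x ->
  exists p, [/\ disk z e p, disk z' e' p & disk c rho p].
Proof.
rewrite /disk /= => zc z'c zz' xz xz'; set D := N (z' - z).
have D0 : 0 < D by rewrite cabs_gt0 subr_eq0 eq_sym.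
have De : D < e + e' by have := cabs_tri z' x z; rewrite (cabsC z' x) -/D; lra.
have e0 : 0 < e by apply: le_lt_trans xz; exact: cabs_ge0.
have e'0 : 0 < e' by apply: le_lt_trans xz'; exact: cabs_ge0.
have s0 : 0 < e + e' by lra.
pose t := e / (e + e').
have t0 : 0 < t by rewrite divr_gt0.
have t1 : 0 < 1 - t.
  by rewrite subr_gt0 ltr_pdivrMr //; lra.
exists (z + rc t * (z' - z)); split.
- rewrite addrC addKr cabsM cabs_rc gtr0_norm // -/D /t mulrAC ltr_pdivrMr //.
  by rewrite ltr_pM2l.
- have -> : z + rc t * (z' - z) - z' = rc (1 - t) * - (z' - z) by rewrite rcB rc1; ring.
  rewrite cabsM cabs_rc gtr0_norm // cabsN -/D.
  have -> : 1 - t = e' / (e + e') by rewrite /t; field; rewrite gt_eqF.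
  by rewrite mulrAC ltr_pdivrMr // ltr_pM2l.
- have rho0 : 0 <= rho by rewrite -zc cabs_ge0.
  rewrite -ltr_sqr ?nnegrE ?cabs_ge0 //.
  have -> : N (z + rc t * (z' - z) - c) ^+ 2 = rho ^+ 2 - t * (1 - t) * D ^+ 2.
    have -> : rho ^+ 2 = (1 - t) * N (z - c) ^+ 2 + t * N (z' - c) ^+ 2.
      by rewrite zc z'c; ring.
    have -> : z + rc t * (z' - z) - c = rc (1 - t) * (z - c) + rc t * (z' - c).
      by rewrite rcB rc1; ring.
    have -> : D = N ((z' - c) - (z - c)) by congr N; ring.
    by rewrite !sqr_cabs !(reD, imD, reN, imN) !(reMr, imMr) !(reD, imD, reN, imN); ring.
  by rewrite ltrBlDr ltrDl; exact: mulr_gt0 (mulr_gt0 t0 t1) (exprn_gt0 _ D0).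
Qed.

Lemma extend_lift (rho : R) phi : 0 < rho -> rho < r -> is_lift (disk c rho) phi ->
  exists2 d : R, 0 < d & exists psi, is_lift (disk c (rho + d)) psi /\ psi c = phi c.
Proof.
move=> rho0 rhor lphi.
have H z : exists ep : R * (C -> C), N (z - c) = rho -> [/\ 0 < ep.1,
    disk z ep.1 `<=` disk c r, is_lift (disk z ep.1) ep.2 &
      forall x, disk c rho x -> disk z ep.1 x -> phi x = ep.2 x].
  case: (eqVneq (N (z - c)) rho) => [zc|nz]; last first.
    by exists (0, id) => /eqP; rewrite (negbTE nz).
  by have [e e0 [psi [h1 h2 h3]]] := boundary_section rho0 rhor lphi zc; exists (e, psi).
have [ep Hep] := choice H.
(* [None] indexes the original disk. The set of an index [Some z] with [z] off the circle is empty,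
   so the default pair chosen there is harmless. *)
pose V (i : option C) := if i is Some z then
  [set x | N (z - c) = rho /\ disk z (ep z).1 x] else disk c rho.
pose ph (i : option C) := if i is Some z then (ep z).2 else phi.
have oV i x : V i x -> exists2 d : R, 0 < d & disk x d `<=` V i.
  case: i => [z [zc xz]|xc] /=.
    exists ((ep z).1 - N (x - z)); first by rewrite subr_gt0.
    by move=> y; rewrite /disk /= => yx; split=> //; have := cabs_tri y x z; lra.
  exists (rho - N (x - c)); first by rewrite subr_gt0.
  by move=> y; rewrite /disk /= => yx; have := cabs_tri y x c; lra.
have lV i : is_lift (V i) (ph i).
  by case: i => [z|] //= x [zc xz]; have [_ _ lz _] := Hep _ zc; exact: lz.
have agree i j x : V i x -> V j x -> ph i x = ph j x.
  case: i j => [z|] [z'|] //=.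
  - move=> [zc xz] [z'c xz']; have [<-//|zz'] := eqVneq z z'.
    have [_ s1 l1 h1] := Hep _ zc; have [_ s2 l2 h2] := Hep _ z'c.
    have [p [pz pz' pc]] := disks_meet_inside zc z'c zz' xz xz'.
    apply: (@lift_unique (disk z (ep z).1 `&` disk z' (ep z').1) _ _ p) => //.
    + by apply: convexI; exact: disk_convex.
    + by move=> y [/s1].
    + by apply: lift_sub l1 => y [].
    + by apply: lift_sub l2 => y [].
    + by rewrite -h1 // -h2.
  - by move=> [zc xz] xc; have [_ _ _ h] := Hep _ zc; rewrite -h.
  - by move=> xc [zc xz]; have [_ _ _ h] := Hep _ zc; rewrite -h.
have [Phi [lPhi ePhi]] := glue_lifts oV lV agree.
have cover x : N (x - c) <= rho -> exists2 d : R, 0 < d & disk x d `<=` \bigcup_i V i.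
  rewrite le_eqVlt => /orP[/eqP xc|xc].
    have [h0 _ _ _] := Hep _ xc; exists (ep x).1 => // y yx.
    by exists (Some x).
  have [d d0 Hd] := oV None x xc.
  by exists d => // y /Hd yV; exists None.
have [d d0 Hd] : exists2 d : R, 0 < d & disk c (rho + d) `<=` \bigcup_i V i.
  (* Compactness by contradiction: uncovered points within [rho + n.+1%:R^-1] of [c] would
     accumulate in the closed disk, each point of which has a covered neighbourhood. *)
  apply: contrapT => nd.
  have Hn n : exists x, N (x - c) < rho + n.+1%:R^-1 /\ ~ (\bigcup_i V i) x.
    apply: contrapT => nx; apply: nd; exists n.+1%:R^-1; first by rewrite invr_gt0 ltr0n.
    by move=> x xc; apply: contrapT => nV; apply: nx; exists x.
  have [u Hu] := choice Hn.
  have u1 n : N (u n) <= N c + rho + 1.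
    have [h _] := Hu n; have := cabs_rev (u n) c.
    have : n.+1%:R^-1 <= 1 :> R by rewrite invf_le1 ?ltr0n // ler1n.
    by move: h; set t := n.+1%:R^-1; lra.
  have [w Hw] := bolzano_weierstrass u1.
  have wc : N (w - c) <= rho.
    apply/ler_addgt0Pr => e e0; have e20 : 0 < e / 2 by rewrite divr_gt0.
    have [k hk kw] := Hw _ e20 (Num.bound `|2 / e|).
    have [h _] := Hu k; have := cabs_tri w (u k) c; rewrite (cabsC w (u k)).
    have : k.+1%:R^-1 <= e / 2.
      rewrite -[e / 2]invrK lef_pV2 ?posrE ?invr_gt0 ?ltr0n // invf_div.
      have := archi_boundP (normr_ge0 (2 / e)); have := ler_norm (2 / e).
      have : (Num.bound `|2 / e|)%:R <= k.+1%:R :> R by rewrite ler_nat leqW.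
      lra.
    by move: h; set t := k.+1%:R^-1; lra.
  have [d d0 Hd] := cover _ wc; have [k _ kw] := Hw _ d0 0%N.
  by have [_] := Hu k; apply; exact: Hd.
exists d => //; exists Phi; split; first exact: lift_sub lPhi.
by rewrite (ePhi None) //= /disk /= subrr cabs0.
Qed.

(** By uniqueness the lifts with value [w0] at [c] on smaller disks glue to one on the disk of
    supremal radius; if that radius were below [r], [extend_lift] would enlarge it. *)
Theorem lifting w0 : 0 < r -> F w0 = A c ->
  exists phi, is_lift (disk c r) phi /\ phi c = w0.
Proof.
move=> r0 Fw0; have cc (t : R) : 0 < t -> disk c t c by rewrite /disk /= subrr cabs0.
pose good (i : R * (C -> C)) := [/\ 0 < i.1, i.1 <= r, is_lift (disk c i.1) i.2 & i.2 c = w0].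
pose S := [set rho : R | exists phi, good (rho, phi)].
have [rho1 [rho10 S1]] : exists rho, 0 < rho /\ S rho.
  have [e e0 [eta eta0 [psi [sub lpsi Hpsi]]]] := local_section (cc _ r0) Fw0.
  exists (Num.min e r); rewrite lt_min e0 r0; split=> //; exists psi; split => //=.
  - by rewrite lt_min e0.
  - by rewrite ge_min lexx orbT.
  - by apply: lift_sub lpsi => x; rewrite /disk /= lt_min => /andP[].
  - by rewrite (Hpsi c w0) //; [exact: cc | rewrite subrr cabs0].
have ubS : ubound S r by move=> rho [phi []].
have hS : has_sup S by split; [exists rho1 | exists r].
set m := sup S.
have m0 : 0 < m by apply: lt_le_trans rho10 _; apply: ub_le_sup S1; exact: hS.2.
have mr : m <= r by apply: ge_sup => //; exists rho1.
pose V i := [set x | good i /\ disk c i.1 x].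
have [Phi [lPhi ePhi]] : exists Phi, is_lift (\bigcup_i V i) Phi /\
    forall i x, V i x -> Phi x = i.2 x.
  apply: (@glue_lifts _ V (fun i => i.2)).
  - move=> i x [gi xc]; exists (i.1 - N (x - c)); first by rewrite subr_gt0.
    by move=> y; rewrite /disk /= => yx; split=> //; rewrite /disk /=; have := cabs_tri y x c; lra.
  - by move=> i x [[_ _ li _] xc]; exact: li.
  - move=> i j x [[i0 ir li ic] xi] [[j0 jr lj jc] xj].
    apply: (@lift_unique (disk c i.1 `&` disk c j.1) _ _ c) => //.
    + by apply: convexI; exact: disk_convex.
    + by move=> y [yi _]; exact: lt_le_trans yi ir.
    + by apply: lift_sub li => y [].
    + by apply: lift_sub lj => y [].
    + by split; exact: cc.
    + by rewrite ic jc.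
have sub : disk c m `<=` \bigcup_i V i.
  move=> x xm; have mx : 0 < m - N (x - c) by rewrite subr_gt0.
  have [rho [phi g] h] := sup_adherent mx hS; exists (rho, phi) => //; split=> //=.
  by rewrite /disk /=; move: h; rewrite -/m; lra.
have lm := lift_sub sub lPhi.
have Phic : Phi c = w0.
  have [phi g] := S1; rewrite (ePhi (rho1, phi)) //; first by have [] := g.
  by split=> //; exact: cc.
have [mr'|mr'] := eqVneq m r; first by exists Phi; rewrite -mr'.
have mlt : m < r by rewrite lt_neqAle mr'.
have [d d0 [psi [lpsi psic]]] := extend_lift m0 mlt lm.
suff : S (Num.min r (m + d)).
  move=> /(ub_le_sup hS.2); rewrite -/m leNgt lt_min mlt; lra.
exists psi; split=> /=.
- by rewrite lt_min r0; lra.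
- by rewrite ge_min lexx.
- by apply: lift_sub lpsi => x; rewrite /disk /= lt_min => /andP[].
- by rewrite psic.
Qed.

Lemma lift_isD phi x a : is_lift (disk c r) phi -> disk c r x -> isD A x a ->
  exists b, [/\ isD F (phi x) b, b != 0 & isD phi x (a / b)].
Proof.
move=> lphi xc Ax; have [b Fb] := FE (phi x).
have [cphi Fphi] := lphi _ xc.
have b0 : b != 0 by apply/eqP => b0; apply: (reg xc Fphi); rewrite -b0.
exists b; split=> //; apply: (implicit_isD (d := r - N (x - c))) Fb b0 cphi _ Ax.
  by rewrite subr_gt0.
move=> y yx; have [] // := lphi y; rewrite /disk /=.
by have := cabs_tri y x c; lra.
Qed.

End Lifts.
End Lifting.

(** * Univalent functions *)

Section Koebe.
Variable R : realType.
Local Notation C := (cplx R).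
Local Notation N := (@cabs R).
Implicit Types (x y z w a b c u : C) (f h H phi psi : C -> C).

Lemma isD_sqr z : isD (fun x => x * x) z (2 * z).
Proof.
by have -> : 2 * z = 1 * z + z * 1; [ring | apply: isDM; exact: isD_id].
Qed.

(** A lift through squaring: its only critical value 0 is omitted by [H], and squares tend to
    infinity along any curve to infinity, so there is no asymptotic value. *)
Lemma holomorphic_sqrt H c (r : R) : 0 < r -> diff_on c r H ->
  (forall x, N (x - c) < r -> H x != 0) -> H c = 1 ->
  exists h, h c = 1 /\ forall x, N (x - c) < r -> h x * h x = H x /\
    forall m, isD H x m -> isD h x (m / (2 * h x)).
Proof.
move=> r0 HD H0 Hc.
have FE x : exists m, isD (fun t : C => t * t) x m by eexists; exact: isD_sqr.
have cH x : N (x - c) < r -> ctsat H x by move=> /HD[m]; exact: isD_cts.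
have reg w x : N (x - c) < r -> w * w = H x -> ~ isD (fun t : C => t * t) w 0.
  move=> xc ww /(isD_unique (isD_sqr w))/eqP; rewrite mulf_eq0 pnatr_eq0 /= => /eqP w0.
  by have := H0 _ xc; rewrite -ww w0 mulr0 eqxx.
have noas x gamma : N (x - c) < r -> ~ asymptotic_curve (fun t => t * t) gamma (H x).
  move=> xc [_ inf /(_ _ ltr01)[s1 H1]].
  have [s0 Hs] := inf (N (H x) + 1).
  have := H1 (Num.max s0 s1); rewrite le_max lexx orbT => /(_ isT).
  have := Hs (Num.max s0 s1); rewrite le_max lexx => /(_ isT).
  set g := gamma _ => h1 h2; have := cabs_rev (g * g) (H x); rewrite cabsM.
  have := cabs_ge0 (H x); nra.
have cc : disk c r c by rewrite /disk /= subrr cabs0.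
have [|h [lh hc]] := lifting FE cH reg noas (w0 := 1) r0; first by rewrite mulr1.
exists h; split=> // x xc; split=> [|m Hx]; first by have [] := lh x xc.
have [b [Fb _ hD]] := lift_isD FE reg lh xc Hx.
by rewrite -(isD_unique Fb (isD_sqr _)).
Qed.

Section Univalent.
Variables (phi : C -> C) (c : C) (r : R).
Hypotheses (phiD : diff_on c r phi).
Hypothesis inj : forall x y, N (x - c) < r -> N (y - c) < r -> phi x = phi y -> x = y.
Hypothesis phi' : forall x, N (x - c) < r -> ~ isD phi x 0.

Lemma univalent_open x : N (x - c) < r -> exists2 d : R, 0 < d & forall e : R,
  0 < e <= d -> exists2 k : R, 0 < k & forall y, N (y - phi x) < k ->
    exists x', [/\ N (x' - x) < e, N (x' - c) < r & phi x' = y].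
Proof.
move=> xc; have [b fb] := phiD xc.
have b0 : b != 0 by apply/eqP => b0; apply: (phi' xc); rewrite -b0.
have rx : 0 < r - N (x - c) by rewrite subr_gt0.
have fDx : diff_on x (r - N (x - c)) phi by apply: diff_on_sub phiD; lra.
have [d /andP[d0 dr] [_ surj]] := local_inverse rx fDx fb b0.
exists d => // e /andP[e0 ed]; exists (N b * e / 8).
  by rewrite divr_gt0 // mulr_gt0 // cabs_gt0.
move=> y yk; have [|x' x'e E] := surj e y _ yk; first by rewrite e0.
by exists x'; split=> //; have := cabs_tri x' x c; lra.
Qed.

(* Let [w] be a value omitted by [phi].  A square root [h] of
   [(w - phi) / (w - phi c)] cannot take both values [u] and [- u].  If all
   values closer to [phi c] than [w - phi c] are taken up to the factor 2, then
   [h] covers a disk about 1, so it omits a disk about -1, and the Cauchy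
   estimate for [1 / (h + 1)] bounds [h'] at [c]. *)
Lemma omitted_value_far w b : 0 < r -> isD phi c b ->
  (forall x, N (x - c) < r -> phi x != w) ->
  (forall y, N (y - phi c) < N (w - phi c) / 2 -> exists2 x, N (x - c) < r & phi x = y) ->
  r * N b / 320 <= N (w - phi c).
Proof.
move=> r0 phib om half; set a := phi c in half *; set D := w - a in half *.
have cc : N (c - c) < r by rewrite subrr cabs0.
have D0 : D != 0 by rewrite subr_eq0 eq_sym om.
have ND : 0 < N D by rewrite cabs_gt0.
pose H x := (w - phi x) * D^-1.
have HDe x m : isD phi x m -> isD H x (- m / D).
  move=> fx; have -> : - m / D = (0 - m) * D^-1 + (w - phi x) * 0 by ring.
  by apply: isDM; [apply: isDB => //; exact: isD_cst | exact: isD_cst].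
have HD : diff_on c r H by move=> x /phiD[m /HDe]; eexists; eauto.
have H0 x : N (x - c) < r -> H x != 0.
  by move=> xc; rewrite mulf_neq0 ?invr_eq0 // subr_eq0 eq_sym om.
have Hc : H c = 1 by rewrite /H -/a -/D divff.
have Hinj x y : N (x - c) < r -> N (y - c) < r -> H x = H y -> x = y.
  move=> xc yc /(mulIf (_ : D^-1 != 0)); rewrite invr_eq0 => /(_ D0) E.
  by move/addrI/oppr_inj: E; exact: inj.
have [h [hc Hh]] := holomorphic_sqrt r0 HD H0 Hc.
have hh x : N (x - c) < r -> h x * h x = H x by move=> /Hh[].
have hn0 x : N (x - c) < r -> h x != 0.
  by move=> xc; apply: contraNneq (H0 _ xc) => hx; rewrite -hh // hx mulr0.
have hDe x m : N (x - c) < r -> isD phi x m -> isD h x (- m / D / (2 * h x)).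
  by move=> xc /HDe; have [_] := Hh _ xc; apply.
have hD : diff_on c r h by move=> x xc; have [m /(hDe _ _ xc)] := phiD xc; eexists; eauto.
have u0 u : N (u - 1) < 1 / 5 -> u != 0.
  by move=> u1; apply: contraTneq u1 => ->; rewrite sub0r cabsN cabs1; lra.
have opp x y : N (x - c) < r -> N (y - c) < r -> h x != 0 -> h x = - h y -> False.
  move=> xc yc hx E; have xy : x = y by apply: Hinj => //; rewrite -!hh // E mulrNN.
  move: E hx; rewrite xy => /eqP; rewrite -subr_eq0 opprK -mulr2n mulrn_eq0 /=.
  by move=> /eqP ->; rewrite eqxx.
(* [phi] takes the value [a + D * (1 - u * u)] exactly where [H] equals [u * u]. It is in the
   covered disk, as the modulus of [1 - u * u] is below 1/5 times 11/5, which is less than 1/2. *)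
have take u : N (u - 1) < 1 / 5 ->
    exists y, N (y - c) < r /\ exists2 s : C, s * s = 1 & h y = s * u.
  move=> u1; have [|y yc phiy] := half (a + D * (1 - u * u)).
    rewrite addrC addKr cabsM; have -> : 1 - u * u = - ((u - 1) * ((u - 1) + 2)) by ring.
    rewrite cabsN cabsM ltr_pdivlMr // -mulrA gtr_pMr //.
    by have := cabsD (u - 1) 2; rewrite cabs_nat; have := cabs_ge0 (u - 1); nra.
  exists y; split=> //; exists (h y / u); last by rewrite divfK // u0.
  have := hh _ yc; rewrite /H phiy => E.
  have un0 := u0 _ u1.
  have -> : h y / u * (h y / u) = (h y * h y) / (u * u) by field.
  by rewrite E /D; field; apply/andP; split.
have omit x : N (x - c) < r -> 1 / 5 <= N (h x + 1).
  move=> xc; rewrite leNgt; apply/negP => x1.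
  set u1 := - h x; have u11 : N (u1 - 1) < 1 / 5 by rewrite /u1 -opprD cabsN.
  pose u t := 1 + rc t * (u1 - 1).
  have uu t : 0 <= t <= 1 -> N (u t - 1) < 1 / 5.
    move=> /andP[t0 t1]; rewrite /u addrC addKr cabsM cabs_rc ger0_norm //.
    by apply: le_lt_trans u11; apply: ler_piMl => //; exact: cabs_ge0.
  have ust s t : N (u s - u t) = `|s - t| * N (u1 - 1).
    have -> : u s - u t = rc (s - t) * (u1 - 1) by rewrite /u rcB; ring.
    by rewrite cabsM cabs_rc.
  (* On the segment from 1 to [- h x], one of [u t] and [- u t] is a value of [h] and never both. By
     local surjectivity the sign cannot change, so [h], starting from [h c = 1], would take the
     value [- h x]. *)
  have := @segment_induction R (fun t => exists2 y, N (y - c) < r & h y = u t).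
  case.
  - by exists c => //; rewrite hc /u rc0 mul0r addr0.
  - move=> t t01; have [y [yc [s ss hy]]] := take _ (uu _ t01).
    have [m fy] := phiD yc; have hy' := hDe _ _ yc fy.
    have ry : 0 < r - N (y - c) by rewrite subr_gt0.
    have hDy : diff_on y (r - N (y - c)) h by apply: diff_on_sub hD; lra.
    have m0 : m != 0 by apply/eqP => m0; apply: (phi' yc); rewrite -m0.
    have b0 : - m / D / (2 * h y) != 0.
      by rewrite !mulf_neq0 ?oppr_eq0 ?invr_eq0 ?mulf_neq0 ?pnatr_eq0 ?hn0.
    have [d /andP[d0 dr] [_ surj]] := local_inverse ry hDy hy' b0.
    set b' := - m / D / (2 * h y) in b0 surj.
    have k0 : 0 < N b' * d / 8 by rewrite divr_gt0 // mulr_gt0 // cabs_gt0.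
    have Ns : N s = 1.
      apply/eqP; rewrite -(@eqrXn2 _ 2) ?cabs_ge0 // expr1n expr2 -cabsM ss cabs1 //.
    have d10 : 0 < N (u1 - 1) + 1 by have := cabs_ge0 (u1 - 1); lra.
    exists (N b' * d / 8 / (N (u1 - 1) + 1)); first by rewrite divr_gt0.
    move=> t' t'01; rewrite ltr_pdivlMr // => t't.
    have [||y' y'd hy'u] := surj d (s * u t'); first by rewrite d0 lexx.
      rewrite hy -mulrBr cabsM Ns mul1r ust.
      by have := normr_ge0 (t' - t); have := cabs_ge0 (u1 - 1); nra.
    have y'c : N (y' - c) < r by have := cabs_tri y' y c; lra.
    have : (s - 1) * (s + 1) = 0 by have -> : (s - 1) * (s + 1) = s * s - 1; [ring | rewrite ss subrr].
    move=> /eqP; rewrite mulf_eq0 subr_eq0 addr_eq0 => /orP[]/eqP sE.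
      by split=> _; [exists y | exists y'] => //; rewrite ?hy ?hy'u sE mul1r.
    split=> -[z zc hz]; exfalso.
      by apply: (opp z y' zc y'c (hn0 _ zc)); rewrite hz hy'u sE mulN1r opprK.
    by apply: (opp z y zc yc (hn0 _ zc)); rewrite hz hy sE mulN1r opprK.
  move=> y yc; rewrite /u rc1 mul1r (addrC 1) subrK /u1 => hy.
  exact: (opp y x yc xc (hn0 _ yc)).
have h10 x : N (x - c) < r -> h x + 1 != 0.
  by move=> /omit; rewrite -cabs_gt0; lra.
have GD x m : N (x - c) < r -> isD h x m -> isD (fun x => (h x + 1)^-1) x (- m / (h x + 1) ^+ 2).
  move=> xc hx; apply: isDV; first exact: h10.
  by rewrite -[m]addr0; apply: isDD => //; exact: isD_cst.
have GD' : diff_on c r (fun x => (h x + 1)^-1).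
  by move=> x xc; have [m /(GD _ _ xc)] := hD _ xc; eexists; eauto.
have GM x : N (x - c) < r -> N ((h x + 1)^-1) <= 5.
  move=> xc; rewrite cabsV -[5]invrK lef_pV2 ?posrE ?invr_gt0 ?cabs_gt0 ?h10 //.
  by have := omit _ xc; lra.
have c4 : N (c - c) < r / 4 by rewrite subrr cabs0 divr_gt0.
(* Here 320 = 8 * 5 * 8: the derivative bound is [8 * 5 / r], and the derivative of [(h + 1)^-1] at
   [c] is [b / (8 * D)]. *)
have := derivative_bound GD' GM c4 (GD _ _ cc (hDe _ _ cc phib)).
rewrite hc.
have -> : - (- b / D / (2 * 1)) / (1 + 1) ^+ 2 = b / (8 * D) by field.
rewrite cabsf cabsM cabs_nat ler_pdivrMr ?mulr_gt0 // => h1.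
rewrite ler_pdivrMr // mulrC -ler_pdivlMr //.
by apply: le_trans h1 _; rewrite le_eqVlt; apply/orP; left; apply/eqP; field; rewrite gt_eqF.
Qed.

(** Let [m] be the infimum of the distances of omitted values from [phi c]. An omitted value closer
    than [2 * m] satisfies the covering condition of [omitted_value_far], so no minimum has to be
    attained. *)
Theorem koebe b : 0 < r -> isD phi c b -> forall y, N (y - phi c) < r * N b / 320 ->
  exists2 x, N (x - c) < r & phi x = y.
Proof.
move=> r0 phib y0 y0b; apply: contrapT => nx.
have cc : N (c - c) < r by rewrite subrr cabs0.
pose Om := [set t : R | exists w, (forall x, N (x - c) < r -> phi x != w) /\ N (w - phi c) = t].
have Oy0 : Om (N (y0 - phi c)).
  by exists y0; split=> // x xc; apply/eqP => E; apply: nx; exists x.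
have [d d0 Hd] := univalent_open cc.
have [|k k0 Hk] := Hd d; first by rewrite d0 lexx.
have lbk : lbound Om k.
  move=> t [w [om <-]]; rewrite leNgt; apply/negP => wk.
  by have [x [_ xc E]] := Hk _ wk; have := om _ xc; rewrite E eqxx.
have hO : has_inf Om by split; [exists (N (y0 - phi c)) | exists k].
set m := inf Om.
have km : k <= m by apply: lb_le_inf => //; exists (N (y0 - phi c)).
have m0 : 0 < m by lra.
have my0 : m <= N (y0 - phi c) by apply: ge_inf => //; exact: hO.2.
pose e := Num.min m (r * N b / 320 - m).
have e0 : 0 < e by rewrite lt_min m0 /=; lra.
have [t [w [om wt]] te] := inf_adherent e0 hO.
have em : e <= m by rewrite /e ge_min lexx.
have eb : e <= r * N b / 320 - m by rewrite /e ge_min lexx orbT.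
rewrite -/m in te.
have : r * N b / 320 <= N (w - phi c).
  apply: omitted_value_far om _ => // y yw; apply: contrapT => ny.
  suff : m <= N (y - phi c) by rewrite wt in yw; lra.
  apply: ge_inf; first exact: hO.2.
  by exists y; split=> // x xc; apply/eqP => E; apply: ny; exists x.
by rewrite wt; lra.
Qed.

End Univalent.

Section UnivalentGrowth.
Variables (phi : C -> C) (c : C) (r : R).
Hypotheses (phiD : diff_on c r phi).
Hypothesis inj : forall x y, N (x - c) < r -> N (y - c) < r -> phi x = phi y -> x = y.
Hypothesis phi' : forall x, N (x - c) < r -> ~ isD phi x 0.

(* The Koebe theorem for the inverse function. *)
Lemma univalent_growth b : 0 < r -> isD phi c b ->
  forall x, N (x - c) < r / 320 ^+ 2 -> N (phi x - phi c) < r * N b / 320.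
Proof.
move=> r0 phib x xr.
have cc : N (c - c) < r by rewrite subrr cabs0.
have b0 : b != 0 by apply/eqP => b0; apply: (phi' cc); rewrite -b0.
have Nb : 0 < N b by rewrite cabs_gt0.
set s := r * N b / 320; have s0 : 0 < s by rewrite divr_gt0 // mulr_gt0.
have H y : exists x, N (y - phi c) < s -> N (x - c) < r /\ phi x = y.
  case: (ltP (N (y - phi c)) s) => [/(koebe phiD inj phi' r0 phib)[t tc E]|_]; last by exists 0.
  by exists t.
have [psi Hpsi] := choice H.
have cps y : N (y - phi c) < s -> ctsat psi y.
  move=> ys e e0; have [h1 h2] := Hpsi _ ys.
  have [d d0 Hd] := univalent_open phiD phi' h1.
  have m0 : 0 < Num.min e d <= d by rewrite lt_min e0 d0 ge_min lexx orbT.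
  have [k k0 Hk] := Hd _ m0; rewrite h2 in Hk.
  exists (Num.min k (s - N (y - phi c))); first by rewrite lt_min k0 subr_gt0.
  move=> y'; rewrite lt_min => /andP[/Hk[x' [x1 x2 x3]] y's].
  have {}y's : N (y' - phi c) < s by have := cabs_tri y' y (phi c); lra.
  have [h3 h4] := Hpsi _ y's.
  have -> : psi y' = x' by apply: inj => //; rewrite h4 x3.
  by apply: lt_le_trans x1 _; rewrite ge_min lexx.
have dps y m : N (y - phi c) < s -> isD phi (psi y) m -> m != 0 -> isD psi y (1 / m).
  move=> ys fm m0.
  apply: (implicit_isD (F := phi) (A := fun x => x) (d := s - N (y - phi c))) => //.
  - by rewrite subr_gt0.
  - exact: cps.
  - by move=> y' y'y; have [] // := Hpsi y'; have := cabs_tri y' y (phi c); lra.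
  - exact: isD_id.
have dn0 y m : N (y - phi c) < s -> isD phi (psi y) m -> m != 0.
  move=> ys fm; apply/eqP => m0; have [h1 _] := Hpsi _ ys.
  by apply: (phi' h1); rewrite -m0.
have psid y : N (y - phi c) < s -> exists2 m, m != 0 & isD psi y m.
  move=> ys; have [h1 _] := Hpsi _ ys; have [m fm] := phiD h1.
  have m0 := dn0 _ _ ys fm; exists (1 / m); last exact: dps.
  by rewrite mul1r invr_eq0.
have c0 : N (phi c - phi c) < s by rewrite subrr cabs0.
have psic : psi (phi c) = c.
  by have [h1 h2] := Hpsi _ c0; apply: inj.
have psib : isD psi (phi c) (1 / b) by apply: dps => //; rewrite psic.
have psiD : diff_on (phi c) s psi by move=> y /psid[m _]; exists m.
have psi_inj y y' : N (y - phi c) < s -> N (y' - phi c) < s -> psi y = psi y' -> y = y'.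
  by move=> /Hpsi[_ h] /Hpsi[_ h'] E; rewrite -h -h' E.
have psi' y : N (y - phi c) < s -> ~ isD psi y 0.
  by move=> /psid[m m0 /isD_unique H0] /H0 mE; rewrite mE eqxx in m0.
have := koebe psiD psi_inj psi' s0 psib (y := x).
rewrite psic mul1r cabsV.
have -> : s * (N b)^-1 / 320 = r / 320 ^+ 2 by rewrite /s; field; rewrite gt_eqF.
by move=> /(_ xr)[y ys <-]; have [_ ->] := Hpsi _ ys.
Qed.

End UnivalentGrowth.

(** The growth bound on the disk of radius [r * 320 ^+ 2] reads [320 * N l * r] for [N x < r]; this
    is linear growth. *)
Lemma univalent_entire_affine f : (forall x, exists m, isD f x m) -> injective f ->
  (forall x, ~ isD f x 0) -> exists a b, forall x, f x = a + b * x.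
Proof.
move=> fE fi f'; have [l fl] := fE 0.
have fi' (r : R) x y : N (x - 0) < r -> N (y - 0) < r -> f x = f y -> x = y.
  by move=> _ _; exact: fi.
have f0' (r : R) x : N (x - 0) < r -> ~ isD f x 0 by move=> _; exact: f'.
have [|b Hb] := @linear_growth _ f fE 0 (320 * N l).
  move=> r x xr; have r0 : 0 < r by apply: le_lt_trans xr; exact: cabs_ge0.
  have R0 : 0 < r * 320 ^+ 2 by rewrite mulr_gt0 // exprn_gt0.
  have := univalent_growth (@entire_diff_on _ f fE 0 _) (@fi' _) (@f0' _) R0 fl (x := x).
  rewrite mulfK ?expf_neq0 ?pnatr_eq0 // => /(_ xr) h.
  apply: ltW; apply: lt_le_trans h _; rewrite le_eqVlt; apply/orP; left; apply/eqP.
  by field.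
by exists (f 0), b => x; rewrite Hb subr0.
Qed.
End Koebe.

(** * Iteration *)

Section Iteration.
Variable R : realType.
Local Notation C := (cplx R).
Local Notation N := (@cabs R).
Implicit Types (x y z w a b c : C) (f h F phi : C -> C) (n : nat).

Lemma entire_isD f : entire f -> forall x, exists m, isD f x m.
Proof. by move=> fE x; exists (derive1 f x); apply: derivable_isD; exact: fE. Qed.

Lemma transcendental_not_affine f : transcendental_entire f ->
  ~ exists a b, forall x, f x = a + b * x.
Proof.
move=> [_ np] [a [b H]]; apply: np; exists (a%:P + b *: 'X) => x.
by rewrite H hornerD hornerC hornerZ hornerX.
Qed.

Section Iterates.
Variable f : C -> C.
Hypothesis fE : forall x, exists m, isD f x m.

Lemma iter_isD n x : exists m, isD (iter n f) x m.
Proof.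
elim: n => [|n [m IH]]; first by exists 1; exact: isD_id.
by have [b fb] := fE (iter n f x); exists (b * m); exact: isD_comp IH fb.
Qed.

Lemma iter_fixed n c : f c = c -> iter n f c = c.
Proof. by move=> fc; elim: n => //= n ->. Qed.

Lemma iter_isD_fixed n c l : f c = c -> isD f c l -> isD (iter n f) c (l ^+ n).
Proof.
move=> fc fl; elim: n => [|n IH]; first by rewrite expr0; exact: isD_id.
by rewrite exprS; apply: (isD_comp (h := f) IH); rewrite iter_fixed.
Qed.

Hypothesis naff : ~ exists a b, forall x, f x = a + b * x.

(** Equal iterates give an identity only on the range of the lower one; the identity theorem needs a
    disk in it. As [f] is not constant, each disk contains a noncritical point, near which [f] is
    open. *)
Lemma iter_range n : exists a, exists2 d : R, 0 < d &
  forall y, N (y - a) < d -> exists x, iter n f x = y.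
Proof.
elim: n => [|n [a [d d0 Hd]]]; first by exists 0, 1 => // y _; exists y.
have [p pa fp] : exists2 p, N (p - a) < d & ~ isD f p 0.
  apply: contrapT => np; apply: naff; exists (f a), 0 => x; rewrite mul0r addr0.
  apply: (zero_derivative_entire fE d0) => p pa.
  by apply: contrapT => fp; apply: np; exists p.
have [b fb] := fE p; have b0 : b != 0 by apply/eqP => b0; apply: fp; rewrite -b0.
have rp : 0 < d - N (p - a) by rewrite subr_gt0.
have [e /andP[e0 ed] [_ surj]] :=
  local_inverse rp (@entire_diff_on _ f fE p _) fb b0.
exists (f p), (N b * e / 8); first by rewrite divr_gt0 // mulr_gt0 // cabs_gt0.
move=> y yp; have [|x xp fx] := surj e y _ yp; first by rewrite e0 lexx.
have [|x' x'x] := Hd x; first by have := cabs_tri x p a; lra.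
by exists x'; rewrite /= x'x.
Qed.

(** A repetition makes some positive iterate the identity, so [f] would be injective without
    critical points, hence affine. This makes sequences of iterates admissible in
    [limit_function]. *)
Lemma iter_injective (m n : nat) : iter m f = iter n f -> m = n.
Proof.
wlog mn : m n / (m < n)%N.
  by move=> H E; case: (ltngtP m n) => // h; [|apply/esym]; exact: H.
move=> E; exfalso; pose k := (n - m).-1.
have nk : n = (k.+1 + m)%N by rewrite /k; lia.
have [a [d d0 Hd]] := iter_range m.
have idk x : iter k.+1 f x = x.
  apply/eqP; rewrite -subr_eq0; apply/eqP.
  have gE y : exists l, isD (fun x => iter k.+1 f x - x) y l.
    have [l hl] := iter_isD k.+1 y; exists (l - 1); exact: isDB hl (isD_id y).
  apply: (identity_entire gE d0 (c := a)) => y /Hd[y' <-].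
  by rewrite -iterD -nk -E subrr.
apply: naff; apply: univalent_entire_affine => // [x y fxy|x f0].
  by rewrite -(idk x) -(idk y) !iterSr fxy.
have [l hl] := iter_isD k (f x).
have := isD_comp f0 hl; rewrite mulr0.
have -> : (fun x => iter k f (f x)) = fun x => x.
  by apply/funext => y; rewrite -iterSr idk.
by move=> /(isD_unique (isD_id x))/eqP; rewrite oner_eq0.
Qed.

End Iterates.

Lemma isD_critical_value F w : isD F w 0 -> Sing F (F w).
Proof. by move=> /isD_derive1 F0; left; left; exists w. Qed.

Lemma asymptotic_curve_value F gamma a : asymptotic_curve F gamma a -> Sing F a.
Proof.
move=> [cg gi Fg]; left; right; exists gamma; split.
- apply/subspace_continuousP => s /= s0; apply/cvg_cabsP => e e0.
  have [d d0 Hd] := cg s s0 e e0.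
  rewrite near_withinE; apply/nbhs_ballP; exists d => // t /=.
  by rewrite /ball /= distrC => td t0; exact: Hd.
- move=> M; have [s0 Hs] := gi M; near=> t.
  rewrite normC_cabs [_%:C%C]/(rc M) ltr_rc; apply: Hs.
  by near: t; apply: nbhs_pinfty_ge; exact: num_real.
- apply/cvg_cabsP => e /Fg[s0 Hs]; near=> t; apply: Hs.
  by near: t; apply: nbhs_pinfty_ge; exact: num_real.
Unshelve. all: by end_near. Qed.

Lemma uniform_cabs (A : set C) (t : nat -> C -> C) h : {uniform A, t @ \oo --> h} ->
  forall e : R, 0 < e -> exists n0, forall n, (n0 <= n)%N ->
    forall x, A x -> N (t n x - h x) < e.
Proof.
move=> H e e0.
pose P := [set u : C -> C | forall x, A x -> N (u x - h x) < e].
have [|n0 _ Hn] := H P; last by exists n0 => n /Hn.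
apply/uniform_nbhs; exists [set p | N (p.2 - p.1) < e]; split=> //.
rewrite -entourage_ballE; exists (rc e) => /=; first by rewrite -rc0 ltr_rc.
by move=> [x y] /=; rewrite /ball /= normC_cabs ltr_rc cabsC.
Qed.

Lemma segment_connects (A : set C) x y :
  (forall t : R, 0 <= t <= 1 -> A (x + rc t * (y - x))) ->
  connected_component A x y.
Proof.
move=> H; pose g (t : R) : C := x + rc t * (y - x).
have cg : continuous g.
  move=> t; apply/cvg_cabsP => e e0.
  have d0 : 0 < e / (N (y - x) + 1) by rewrite divr_gt0 // ltr_wpDl ?cabs_ge0.
  apply/nbhs_ballP; exists (e / (N (y - x) + 1)) => // s.
  rewrite /ball /= distrC ltr_pdivlMr ?ltr_wpDl ?cabs_ge0 // => h.
  have -> : g s - g t = rc (s - t) * (y - x) by rewrite /g rcB; ring.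
  rewrite cabsM cabs_rc; have := normr_ge0 (s - t); have := cabs_ge0 (y - x); nra.
exists (g @` `[0, 1]%classic); last first.
  exists 1; first by rewrite /= in_itv /= ler01 lexx.
  by rewrite /g rc1 mul1r (addrC x) subrK.
split.
- exists 0; first by rewrite /= in_itv /= ler01 lexx.
  by rewrite /g rc0 mul0r addr0.
- by move=> _ [t /= t01 <-]; apply: H; move: t01; rewrite in_itv.
- apply: connected_continuous_connected; first exact: segment_connected.
  exact: continuous_subspaceT.
Qed.

Lemma Fatou_component_open (G : set (C -> C)) U c : Fatou_component G U -> U c ->
  exists2 d : R, 0 < d & disk c d `<=` U.
Proof.
move=> [z Fz ->] Uc; have [V [oV nV] Vc] := connected_component_sub Uc.
have /nbhsP[d d0 Hd] : nbhs c V by apply: open_nbhs_nbhs.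
exists d => // y yd; apply: connected_component_trans Uc _.
apply: segment_connects => t t01; exists V => //; apply: Hd.
by apply: disk_convex => //; rewrite /disk /= subrr cabs0.
Qed.

End Iteration.

(** * The constant limit as a fixed point, and its multiplier *)

Section LimitPoint.
Variable R : realType.
Local Notation C := (cplx R).
Local Notation N := (@cabs R).
Implicit Types (x y z w a b c : C) (f h F phi : C -> C) (n : nat).

(** The identity is lifted through [F]; the multiplier is nonzero because [c = F c] is not a
    critical value. *)
Lemma inverse_branch F c (r : R) l : (forall x, exists m, isD F x m) -> 0 < r ->
  F c = c -> isD F c l -> (forall x, N (x - c) < r -> ~ Sing F x) ->
  l != 0 /\ exists phi,
   [/\ phi c = c, isD phi c (1 / l), diff_on c r phi,
       forall x y, N (x - c) < r -> N (y - c) < r -> phi x = phi y -> x = y &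
       (forall x, N (x - c) < r -> ~ isD phi x 0) /\
       forall x, N (x - c) < r -> F (phi x) = x].
Proof.
move=> FE r0 Fc Fl nS.
have cc : N (c - c) < r by rewrite subrr cabs0.
have cI x : N (x - c) < r -> ctsat (fun t : C => t) x by move=> _; exact: cts_id.
have reg w x : N (x - c) < r -> F w = x -> ~ isD F w 0.
  by move=> xc wx /isD_critical_value; rewrite wx; exact: nS.
have noas x gamma : N (x - c) < r -> ~ asymptotic_curve F gamma x.
  by move=> xc /asymptotic_curve_value; exact: nS.
have [phi [lphi phic]] := lifting FE cI reg noas r0 Fc.
split; first by apply/eqP => l0; apply: (reg _ _ cc Fc); rewrite -l0.
have Fphi x : N (x - c) < r -> F (phi x) = x by move=> /lphi[].
have dphi x : N (x - c) < r ->
    exists b, [/\ isD F (phi x) b, b != 0 & isD phi x (1 / b)].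
  by move=> xc; apply: (lift_isD FE reg lphi xc); exact: isD_id.
exists phi; split=> //.
- have [b [Fb _]] := dphi _ cc; rewrite phic in Fb.
  by rewrite (isD_unique Fl Fb).
- by move=> x /dphi[b [_ _ ?]]; exists (1 / b).
- by move=> x y /Fphi {2}<- /Fphi {2}<- ->.
- split=> // x /dphi[b [_ b0 phib]] /(isD_unique phib)/eqP.
  by rewrite mul1r invr_eq0 (negbTE b0).
Qed.

Section FixedPoint.
Variables (f : C -> C) (c l : C) (r : R).
Hypothesis fE : forall x, exists m, isD f x m.
Hypotheses (r0 : 0 < r) (fc : f c = c) (fl : isD f c l).
Hypothesis nS : forall n x, N (x - c) < r -> ~ Sing (iter n.+1 f) x.

(** The radius [r] is the same for all [n]. The shift to [n.+1] leaves out the identity, which is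
    not among the generated maps. *)
Let branch n := inverse_branch (iter_isD fE n.+1) r0 (iter_fixed n.+1 fc)
  (iter_isD_fixed n.+1 fc fl) (@nS n).

(* The inverse branches of [f ^ n] at an attracting fixed point expand, so that
   by the Koebe theorem [f] is univalent on arbitrarily large disks. *)
Lemma attracting_affine : N l < 1 -> exists a b, forall x, f x = a + b * x.
Proof.
move=> l1; have l0 : l != 0.
  by have [] := branch 0; rewrite expr1.
have Nl : 0 < N l by rewrite cabs_gt0.
(* One branch has both points in its image, on which [iter n.+1 f] is injective; hence [f x = f y]
   forces [x = y]. A critical point in the image would yield a critical value in the disk. *)
have far x y : exists n phi, [/\
    (forall x, N (x - c) < r -> iter n.+1 f (phi x) = x),
    exists2 x', N (x' - c) < r & phi x' = x & exists2 y', N (y' - c) < r & phi y' = y].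
  have q1 : 1 < (N l)^-1 by rewrite invf_gt1.
  have [n Hn] := geom_big (320 * (N (x - c) + N (y - c)) / r) q1.
  have [ln [phi [phic phil phiD inj [phi' Fphi]]]] := branch n.
  have big z : N (z - c) <= N (x - c) + N (y - c) ->
      exists2 z', N (z' - c) < r & phi z' = z.
    move=> zb; apply: (koebe phiD inj phi' r0 phil); rewrite phic.
    apply: le_lt_trans zb _; rewrite mul1r cabsV cabsX -exprVn.
    rewrite ltr_pdivlMr // mulrC -(ltr_pdivrMl _ _ r0) mulrC.
    have -> : r^-1 * ((N (x - c) + N (y - c)) * 320) =
      320 * (N (x - c) + N (y - c)) / r by ring.
    apply: lt_le_trans Hn _; rewrite exprS ler_peMl ?exprn_ge0 ?invr_ge0 ?cabs_ge0 //.
    exact: ltW.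
  by exists n, phi; split=> //; apply: big; rewrite ?lerDl ?lerDr cabs_ge0.
apply: univalent_entire_affine => // [x y fxy|x f0].
  have [n [phi [Fphi [x' xr xE] [y' yr yE]]]] := far x y.
  have : iter n.+1 f x = iter n.+1 f y by rewrite !iterSr fxy.
  by rewrite -xE -yE !Fphi // => ->.
have [n [phi [Fphi [x' xr xE] _]]] := far x x.
have [m hm] := iter_isD fE n (f x).
have := isD_comp f0 hm; rewrite mulr0.
have -> : (fun x => iter n f (f x)) = iter n.+1 f by apply/funext => y; rewrite iterSr.
move=> /isD_critical_value; rewrite -xE Fphi //; exact: nS.
Qed.

(** If [l] has modulus 1, a point [z1] of the orbit near [c] is [phi x] for a later point [x] of the
    orbit; a Lipschitz bound common to all branches keeps [x] away from [c] unless [z1 = c]. If the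
    modulus exceeds 1, the distance to [c] cannot decrease near [c], so it tends to 0 only by being
    0. *)
Lemma nonattracting_orbit z : 1 <= N l -> seqlim (fun n => iter n f z) c ->
  exists n, iter n f z = c.
Proof.
move=> l1 zc; rewrite le_eqVlt in l1; case/orP: l1 => [/eqP l1|l1].
  apply: contrapT => nc.
  have s0 : 0 < r / 320 by rewrite divr_gt0.
  have [m Hm] := zc _ s0.
  set z1 := iter m f z; have z1c : N (z1 - c) < r / 320 by exact: Hm.
  have z10 : 0 < N (z1 - c).
    by rewrite cabs_gt0 subr_eq0; apply/eqP => E; apply: nc; exists m.
  set t := r / 320 ^+ 2; have t0 : 0 < t by rewrite divr_gt0 // exprn_gt0.
  (* 2560 is the Lipschitz constant [8 * (r / 320) / t]: on the disk of radius [t],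
     [univalent_growth] bounds [phi - c] by [r / 320]. *)
  have e0 : 0 < Num.min (t / 4) (N (z1 - c) / 2560) by rewrite lt_min; apply/andP; split; exact: divr_gt0.
  have [k Hk] := zc _ e0.
  have [ln [phi [phic phil phiD inj [phi' Fphi]]]] := branch k.
  have Nl : N (1 / l ^+ k.+1) = 1 by rewrite mul1r cabsV cabsX -l1 expr1n invr1.
  have [|x xr xE] := koebe phiD inj phi' r0 phil (y := z1).
    by rewrite phic Nl mulr1.
  have xit : x = iter (k.+1 + m) f z by rewrite iterD -/z1 -xE Fphi.
  have km : (k <= k.+1 + m)%N by rewrite addSn leqW // leq_addr.
  have := Hk _ km; have -> : iter (k.+1 + m) f z = x by rewrite xit.
  rewrite lt_min => /andP[h1 h2].
  have gr := univalent_growth phiD inj phi' r0 phil; rewrite Nl mulr1 phic in gr.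
  have tr : N (c - c) + t <= r.
    by rewrite subrr cabs0 add0r /t ler_pdivrMr ?exprn_gt0 //; lra.
  have pD : diff_on c t (fun x => phi x - c).
    by move=> y /(diff_on_sub tr phiD)[b /(isD_subl c)]; exists b.
  have pM y : N (y - c) < t -> N (phi y - c) <= r / 320 by move=> /gr/ltW.
  have c4 : N (c - c) < t / 4 by rewrite subrr cabs0 divr_gt0.
  have xt : N (x - c) < t by lra.
  have := lipschitz pD pM c4 xt; rewrite phic xE subrr subr0.
  have -> : 8 * (r / 320) / t = 2560 by rewrite /t; field; rewrite gt_eqF.
  lra.
have /isDP/(_ (N l - 1)) := fl; rewrite subr_gt0 => /(_ l1)[d d0 Hd].
have [n Hn] := zc _ d0; exists n; apply/eqP.
have step y : N (y - c) < d -> N (y - c) <= N (f y - c).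
  move=> yd; have := Hd _ yd; rewrite fc.
  have := cabs_rev (l * (y - c)) (f y - c); rewrite (cabsC (l * _)) cabsM.
  have := cabs_ge0 (y - c); nra.
have mono k : N (iter n f z - c) <= N (iter (k + n) f z - c).
  elim: k => // k IH; apply: le_trans IH _; apply: step; apply: Hn; lia.
rewrite -subr_eq0 -cabs_eq0 eq_le cabs_ge0 andbT.
apply/ler_addgt0Pr => e e0; rewrite add0r.
have [k Hk] := zc _ e0; apply: le_trans (mono k) _; apply: ltW; apply: Hk; lia.
Qed.

End FixedPoint.

Lemma strictly_increasing_witness (P : nat -> Prop) :
  (forall n, exists2 m, (n <= m)%N & P m) ->
  exists2 k : nat -> nat, {homo k : m n / (m < n)%N} & forall n, P (k n).
Proof.
move=> H; have H' n : exists m, (n <= m)%N /\ P m by have [m] := H n; exists m.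
have [w Hw] := choice H'.
pose k := fix k n := if n is n'.+1 then w (k n').+1 else w 0%N.
exists k; last by case=> [|n] /=; [have [] := Hw 0%N | have [] := Hw (k n).+1].
apply: homo_ltn; first exact: ltn_trans.
by move=> n /=; have [] := Hw (k n).+1.
Qed.

Section LimitFunctions.
Variables (g : nat -> C -> C) (U : set C) (h : C -> C) (c : C).
Hypothesis gT : forall n, transcendental_entire (g n).
Hypothesis Ulim : limit_function (semigroup g) U (Some h).
Hypothesis hc : forall z, U z -> h z = c.

Let f := g 0.
Let fE : forall x, exists m, isD f x m.
Proof. by apply: entire_isD; have [] := gT 0. Qed.
Let naff := transcendental_not_affine (gT 0).

Lemma semigroup_iter n : semigroup g (iter n.+1 f).
Proof.
elim: n => [|n IH]; first exact: (semigroup_gen g 0).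
exact: (semigroup_comp (semigroup_gen g 0) IH).
Qed.

Lemma iterates_subsequence (k : nat -> nat) : injective k ->
  exists2 k' : nat -> nat, {homo k' : m n / (m < n)%N} &
    forall z, U z -> exists2 W, nbhs z W & forall e : R, 0 < e ->
      exists n0, forall n, (n0 <= n)%N -> forall x, W x -> U x ->
        N (iter (k (k' n)).+1 f x - c) < e.
Proof.
move=> ki; have [||t [k' k'i tE] tl] := Ulim (s := fun n => iter (k n).+1 f).
- by move=> n; exact: semigroup_iter.
- by move=> m n /(iter_injective fE naff)[] /ki.
exists k' => // z Uz; have [W zW WU] := tl _ Uz; exists W => // e e0.
have [n0 Hn] := uniform_cabs WU e0; exists n0 => n nn x Wx Ux.
by have := Hn n nn x (conj Wx Ux); rewrite tE /= hc.
Qed.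

(** If the orbit stayed [e] away from [c] infinitely often, the corresponding iterates would form an
    injective sequence without a subsequence tending to [c]. *)
Lemma orbit_limit z : U z -> seqlim (fun n => iter n f z) c.
Proof.
move=> Uz e e0; apply: contrapT => ne.
have [|k kh kP] := @strictly_increasing_witness (fun n => e <= N (iter n.+1 f z - c)).
  move=> n; apply: contrapT => nm; apply: ne; exists n.+1 => -[//|m] nm'.
  by rewrite ltNge; apply/negP => em; apply: nm; exists m.
have ki : injective k.
  by move=> m n kmn; case: (ltngtP m n) => // /kh; rewrite kmn ltnn.
have [k' k'h Hk'] := iterates_subsequence ki.
have [W zW /(_ _ e0)[n0 Hn]] := Hk' _ Uz.
have := Hn n0 (leqnn _) z (nbhs_singleton zW) Uz.
by rewrite ltNge kP.
Qed.

Lemma limit_fixed z : U z -> f c = c.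
Proof.
move=> Uz; have zc := orbit_limit Uz; have [m /isD_cts fcts] := fE c.
apply: seqlim_unique (seqlim_cts fcts zc) _ => e /zc[n0 Hn].
by exists n0 => n nn; apply: (Hn n.+1); exact: leqW.
Qed.

(** Some iterate maps a disk of radius [s] about [c] into the disk of radius [s / 16]; the
    derivative bound then gives [N l ^+ q <= 1 / 2] for some positive [q]. *)
Lemma interior_limit_attracting l (d : R) : 0 < d -> disk c d `<=` U -> f c = c ->
  isD f c l -> N l < 1.
Proof.
move=> d0 dU fc fl; rewrite ltNge; apply/negP => l1.
have Uc : U c by apply: dU; rewrite /disk /= subrr cabs0.
have [k _ /(_ _ Uc)[W /nbhsP[d' d'0 Wd] H]] := iterates_subsequence (@inj_id nat).
set s := Num.min d d'; have s0 : 0 < s by rewrite lt_min d0.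
have s16 : 0 < s / 16 by rewrite divr_gt0.
have [n0 /(_ _ (leqnn n0)) Hn] := H _ s16.
set q := (k n0).+1 in Hn.
have qD : diff_on c s (fun x => iter q f x - c).
  by move=> x _; have [m /(isD_subl c)] := iter_isD fE q x; exists m.
have qM x : N (x - c) < s -> N (iter q f x - c) <= s / 16.
  by rewrite lt_min => /andP[xd xd']; apply: ltW; apply: Hn; [exact: Wd | exact: dU].
have c4 : N (c - c) < s / 4 by rewrite subrr cabs0 divr_gt0.
have := derivative_bound qD qM c4 (isD_subl c (iter_isD_fixed q fc fl)).
have -> : 8 * (s / 16) / s = 1 / 2 by field; rewrite gt_eqF.
by have := exprn_ege1 q l1; rewrite cabsX; lra.
Qed.

Lemma constant_limit_postsingular z : Fatou_component (semigroup g) U ->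
  invariant_under (semigroup g) U -> U z -> postsingular_set (semigroup g) c.
Proof.
move=> UF Uinv Uz; apply: contrapT => nP.
(* The closure is taken after the union over the whole semigroup, so one radius avoids the singular
   values of all its elements. *)
have [r r0 nS] : exists2 r : R, 0 < r & forall F x, semigroup g F ->
    N (x - c) < r -> ~ Sing F x.
  apply: contrapT => nr; apply: nP => B /nbhsP[d d0 Hd].
  apply: contrapT => nB; apply: nr; exists d => // F x GF xc FS; apply: nB.
  by exists x; split; [exists F | exact: Hd].
have fc := limit_fixed Uz; have [l fl] := fE c.
have nS' n x : N (x - c) < r -> ~ Sing (iter n.+1 f) x.
  by apply: nS; exact: semigroup_iter.
have [l1|l1] := ltP (N l) 1; first exact: naff (attracting_affine fE r0 fc fl nS' l1).
have [n nc] := nonattracting_orbit fE r0 fc fl nS' l1 (orbit_limit Uz).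
have Uc : U c.
  rewrite -nc; case: (n) => // m; apply: (Uinv _ (semigroup_iter m)).
  by exists z.
have [d d0 dU] := Fatou_component_open UF Uc.
by have := interior_limit_attracting d0 dU fc fl; rewrite ltNge l1.
Qed.

End LimitFunctions.
End LimitPoint.

Theorem theorem4p10 (R : realType) (g : nat -> cplx R -> cplx R)
    (U : set (cplx R)) (psi : option (cplx R -> cplx R)) (v : option (cplx R)) :
  (forall n, transcendental_entire (g n)) ->
  Fatou_component (semigroup g) U ->
  invariant_under (semigroup g) U ->
  limit_function (semigroup g) U psi ->
  constant_value U psi v ->
  (Some @` postsingular_set (semigroup g) `|` [set None]) v.
Proof.
move=> gT UF Uinv; case: psi => [h|] Ulim /=; last by move=> ->; right.
move=> [c -> hc]; left; exists c => //.
have [z Fz UE] := UF.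
apply: (constant_limit_postsingular gT Ulim hc UF Uinv (z := z)).
by rewrite UE; exact: connected_component_refl.
Qed.
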